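(* Let $b\ge1$ be an integer and $c\ge0$ a real number, both fixed. For each $n\ge2$ let $\mathcal{E}$ be the collection of all functions $f_C:\mathcal{X}\to\mathcal{Y}$ with $C\in\mathcal{C}$, where $\mathcal{C}$ is the set of $n$-qubit circuits with at most $n^c$ unitary gates, each acting on at most $b$ qubits. Then $\mathcal{E}$ is PAC learnable (with respect to the trace-distance loss) with sample complexity $$\nu(\epsilon,\delta)=O\!\left(\frac{1}{\epsilon^2}\Big(n^{c+1}\ln\frac{n}{\epsilon}+\ln\frac{1}{\delta}\Big)\right),$$ where the implied constant is independent of $n,\epsilon,\delta$ (it may depend on $b$ and $c$).
   Context: $\mathcal{X}=\mathcal{Y}$ is the set of all $n$-qubit pure states, i.e. unit vectors in $(\mathbb{C}^2)^{\otimes n}$ up to global phase; for $x\in\mathcal{X}$ write $|\psi(x)\rangle$ for a representing unit vector. A circuit in $\mathcal{C}$ is a product of at most $n^c$ gates, each gate being an arbitrary unitary acting on some set of at most $b$ of the $n$ qubits (tensored with the identity on the others). Each $C\in\mathcal{C}$ defines $f_C:\mathcal{X}\to\mathcal{Y}$ by $|\psi(f_C(x))\rangle=C|\psi(x)\rangle$. Loss: $\mathcal{L}(y_1,y_2)=\frac12\big\||\psi(y_1)\rangle\langle\psi(y_1)|-|\psi(y_2)\rangle\langle\psi(y_2)|\big\|_1\in[0,1]$, with $\|\cdot\|_1$ the trace norm. For a probability measure $P$ on $\mathcal{X}\times\mathcal{Y}$ and a training set $S=(x_i,y_i)_{i=1}^m$ sampled i.i.d. from $P$, the risk and empirical risk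 of $f$ are $R(f)=\int\mathcal{L}(y,f(x))\,dP(x,y)$ and $\hat R(f)=\frac1m\sum_{i=1}^m\mathcal{L}(y_i,f(x_i))$. Let $\hat h=\arg\min_{h'\in\mathcal{E}}\hat R(h')$ (empirical risk minimizer) and $h=\arg\min_{h'\in\mathcal{E}}R(h')$ (risk minimizer). PAC learnability: a hypothesis space $\mathcal{E}$ is PAC learnable with sample complexity $\nu:(0,1)^2\to\mathbb{N}$ if for all $(\epsilon,\delta)\in(0,1)^2$ and all probability measures $P$ on $\mathcal{X}\times\mathcal{Y}$, whenever $|S|\ge\nu(\epsilon,\delta)$ one has $\mathbb{P}_S\big(R(\hat h)-R(h)\le\epsilon\big)\ge 1-\delta$, where $\mathbb{P}_S$ is the probability over the sampling of $S$. *)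

(* Defs.v *)
From HB Require Import structures.
From mathcomp Require Import all_boot all_order all_algebra spectral.
From mathcomp Require Import generic_quotient complex.
From mathcomp Require Import all_classical all_reals all_analysis.
Import Order.TTheory GRing.Theory Num.Theory.
Import numFieldNormedType.Exports.

Set Implicit Arguments.
Unset Strict Implicit.
Unset Printing Implicit Defensive.

Local Open Scope classical_set_scope.
Local Open Scope sesquilinear_scope.
Local Open Scope quotient_scope.
Local Open Scope ring_scope.

(** * Pure states *)

(* (C^2)^{⊗n} is the space of column vectors whose coordinates, in the
   computational basis, are indexed by the bit strings of length n through
   [enum_val] and [enum_rank]. *)
Notation bitstring n := {ffun 'I_n -> bool}.
Notation qdim n := #|{: bitstring n}|.

Section PureStates.
Variables (R : realType) (n : nat).

Definition is_unit_vector (v : 'cV[R[i]]_(qdim n)) : bool :=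
  \sum_i `|v i 0| ^+ 2 == 1.

Definition unit_vector : Type := {v : 'cV[R[i]]_(qdim n) | is_unit_vector v}.

HB.instance Definition _ := Choice.on unit_vector.

(* The ascription to [R[i]^o] selects the usual topology of the complex plane. *)
HB.instance Definition _ := Topological.copy unit_vector
  (initial_topology
     (fun v : unit_vector => val v : 'cV[R[i]^o : topologicalType]_(qdim n))).

Definition phase_eq (u v : 'cV[R[i]]_(qdim n)) : Prop :=
  exists2 z : R[i], `|z| = 1 & u = z *: v.

Lemma phase_eq_refl u : phase_eq u u.
Proof. by exists 1; rewrite ?normr1 ?scale1r. Qed.

Lemma phase_eq_sym u v : phase_eq u v -> phase_eq v u.
Proof.
case=> z z1 ->; exists z^-1; first by rewrite normfV z1 invr1.
by rewrite scalerA mulVf ?scale1r// -normr_eq0 z1 oner_eq0.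
Qed.

Lemma phase_eq_trans v u w : phase_eq u v -> phase_eq v w -> phase_eq u w.
Proof.
move=> [y y1 ->] [z z1 ->]; exists (y * z); last by rewrite scalerA.
by rewrite normrM y1 z1 mulr1.
Qed.

Definition same_state : rel unit_vector :=
  fun u v => `[< phase_eq (val u) (val v) >].

Lemma same_state_refl : reflexive same_state.
Proof. by move=> u; apply/asboolP; exact: phase_eq_refl. Qed.

Lemma same_state_sym : symmetric same_state.
Proof. by move=> u v; apply/asboolP/asboolP; exact: phase_eq_sym. Qed.

Lemma same_state_trans : transitive same_state.
Proof.
move=> v u w /asboolP uv /asboolP vw; apply/asboolP.
exact: phase_eq_trans uv vw.
Qed.

Canonical same_state_equiv :=
  EquivRel same_state same_state_refl same_state_sym same_state_trans.

Definition state_space : Type :=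
  quotient_topology {eq_quot same_state_equiv}.

HB.instance Definition _ := Topological.on state_space.

Definition basis_vector : 'cV[R[i]]_(qdim n) :=
  \col_i (i == enum_rank [ffun=> false])%:R.

Lemma basis_vector_unit : is_unit_vector basis_vector.
Proof.
rewrite /is_unit_vector (bigD1 (enum_rank [ffun=> false]))//= big1.
  by rewrite mxE eqxx normr1 expr1n addr0.
by move=> i /negPf ni; rewrite mxE ni normr0 expr0n.
Qed.

(* [g_sigma_algebraType] needs a pointed type; the point plays no other role. *)
HB.instance Definition _ := isPointed.Build state_space
  (\pi_({eq_quot same_state_equiv})
     (exist _ basis_vector basis_vector_unit : unit_vector)).

(* n-qubit pure states, with the Borel sigma-algebra of the quotient
   topology. *)
Definition pure_state : Type := g_sigma_algebraType (@open state_space).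

HB.instance Definition _ := Measurable.on pure_state.

Definition ket (x : pure_state) : 'cV[R[i]]_(qdim n) :=
  val (repr (x : {eq_quot same_state_equiv})).

End PureStates.

(** * Circuits *)

Section Circuits.
Variables (R : realType) (n : nat).

Definition restrict_bits (A : {set 'I_n}) (x : bitstring n) :
  {ffun {k | k \in A} -> bool} := [ffun k => x (val k)].

(* U tensored with the identity on the qubits outside A: the (x, y) entry is
   U (x|A, y|A) if x and y agree outside A, and 0 otherwise. *)
Definition extend_gate (A : {set 'I_n})
    (U : 'M[R[i]]_#|{: {ffun {k | k \in A} -> bool}}|) : 'M[R[i]]_(qdim n) :=
  \matrix_(i, j)
    if [forall (k | k \notin A),
          (enum_val i : bitstring n) k == (enum_val j : bitstring n) k]
    then U (enum_rank (restrict_bits A (enum_val i)))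
           (enum_rank (restrict_bits A (enum_val j)))
    else 0.

Definition is_gate (b : nat) (G : 'M[R[i]]_(qdim n)) : Prop :=
  exists (A : {set 'I_n}) (U : 'M[R[i]]_#|{: {ffun {k | k \in A} -> bool}}|),
    [/\ (#|A| <= b)%N, U \is unitarymx & G = extend_gate U].

Definition circuits (b : nat) (c : R) : set 'M[R[i]]_(qdim n) :=
  [set C | exists gs : seq 'M[R[i]]_(qdim n),
    [/\ forall G, G \in gs -> is_gate b G,
        (size gs)%:R <= n%:R `^ c &
        C = \prod_(G <- gs) G]].

(* The functions f_C; the equation |psi(f_C(x))> = C |psi(x)> determines the
   state f_C(x), and holds up to the phase of the chosen representatives. *)
Definition circuit_functions (b : nat) (c : R) :
    set (pure_state R n -> pure_state R n) :=
  [set f | exists2 C, circuits b c C &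
    forall x, phase_eq (ket (f x)) (C *m ket x)].

End Circuits.

(** * Trace-distance loss *)

(* Square root of a positive semidefinite matrix. *)
Definition mxsqrt (C : numClosedFieldType) (N : nat) (M : 'M[C]_N) : 'M[C]_N :=
  invmx (spectralmx M) *m diag_mx (map_mx sqrtC (spectral_diag M))
    *m spectralmx M.

Definition trace_norm (R : realType) (N : nat) (M : 'M[R[i]]_N) : R :=
  complex.Re (\tr (mxsqrt (M^t* *m M))).

Definition trace_loss (R : realType) (n : nat) (y1 y2 : pure_state R n) : R :=
  2^-1 * trace_norm (ket y1 *m (ket y1)^t* - ket y2 *m (ket y2)^t*).

(** * I.i.d. samples *)

Section IidSample.
Context (R : realType) d (T : measurableType d).

Definition tuple_cons m (z : T * m.-tuple T) : m.+1.-tuple T :=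
  [tuple of z.1 :: z.2].

Lemma measurable_tuple_cons m : measurable_fun setT (@tuple_cons m).
Proof. exact: measurable_cons. Qed.

HB.instance Definition _ m := isMeasurableFun.Build _ _ _ _
  (@tuple_cons m) (@measurable_tuple_cons m).

(* The m-fold product measure on m.-tuple T. *)
Fixpoint iid (P : probability T R) (m : nat) : probability (m.-tuple T) R :=
  match m with
  | 0 => \d_([tuple] : 0.-tuple T)
  | m'.+1 => distribution (P \x iid P m')%E (@tuple_cons m')
  end.

End IidSample.

(* Inner probability of an arbitrary event; it is P A when A is measurable. *)
Definition inner_prob (R : realType) d (T : measurableType d)
    (P : probability T R) (A : set T) : \bar R :=
  ereal_sup [set P B | B in [set B | measurable B /\ B `<=` A]].

(** * PAC learning *)

Section Learning.
Context (R : realType) d d' (X : measurableType d) (Y : measurableType d').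
Variable loss : Y -> Y -> R.

Definition risk (P : probability (X * Y)%type R) (f : X -> Y) : R :=
  \int[P]_z loss z.2 (f z.1).

Definition empirical_risk m (S : m.-tuple (X * Y)) (f : X -> Y) : R :=
  m%:R^-1 * \sum_(i < m) loss (tnth S i).2 (f (tnth S i).1).

Definition is_argmin (E : set (X -> Y)) (F : (X -> Y) -> R) (f : X -> Y) :=
  E f /\ forall g, E g -> F f <= F g.

(* An arbitrary selection [hhat] of empirical risk minimizers need not make
   its success event measurable, whence the inner probability. *)
Definition pac_learnable (E : set (X -> Y)) (nu : R -> R -> nat) : Prop :=
  forall eps delta : R, 0 < eps < 1 -> 0 < delta < 1 ->
  forall (P : probability (X * Y)%type R) (m : nat), (nu eps delta <= m)%N ->
  forall (hhat : m.-tuple (X * Y) -> X -> Y) (h : X -> Y),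
    (forall S, is_argmin E (empirical_risk S) (hhat S)) ->
    is_argmin E (risk P) h ->
  ((1 - delta)%:E <=
     inner_prob (iid P m) [set S | (risk P (hhat S) - risk P h <= eps)%R])%E.

End Learning.

(* Main.v *)
Require Import Defs.
From mathcomp Require Import all_boot all_order all_algebra spectral.
From mathcomp Require Import generic_quotient complex.
From mathcomp Require Import all_classical all_reals all_analysis.
From mathcomp Require Import measurable_realfun ring lra.
Import Order.TTheory GRing.Theory Num.Theory.
Import numFieldNormedType.Exports.
Set Implicit Arguments.
Unset Strict Implicit.
Unset Printing Implicit Defensive.
Local Open Scope classical_set_scope.
Local Open Scope sesquilinear_scope.
Local Open Scope quotient_scope.
Local Open Scope ring_scope.

(** The class of circuits is covered by finitely many loss functions, to which
    Chernoff's bound and a union bound apply. For pure states the trace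
    distance is [sqrt (1 - |<y|Cx>|^2)], hence 1/2-Hoelder in the entries of
    [C]; covering at scale [eps] thus only requires approximating [C] to order
    [eps^2], which changes logarithms by a constant factor. A circuit is
    encoded by the at most [n^c] codes of its gates, the code of a gate being
    the qubits it touches and its [4^b] matrix entries rounded to a grid.
    Unitarity makes the errors of the gates add up instead of multiplying, and
    the dimension [2^n] lost by bounding operators entrywise contributes only
    [O(n)] to the logarithm of the grid size, so that the logarithm of the
    number of codes is [O(n^(c+1) ln (n / eps))]. *)

(** * Concentration for i.i.d. samples and finite covers *)

Section IidMoments.
Context (R : realType) d (T : measurableType d).
Implicit Type P : probability T R.

Lemma measurable_tnth_comp m (phi : T -> R) (i : 'I_m) :
  measurable_fun setT phi ->
  measurable_fun setT (fun S : m.-tuple T => phi (tnth S i)).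
Proof.
by move=> mphi; apply: measurableT_comp => //; exact: measurable_tnth.
Qed.

(** Induction on [m]: the sample measure is the push-forward of the product of [P] with the measure
    of the tail, so Tonelli splits off the head coordinate. Nonnegativity of [phi] dispenses with
    integrability. For [phi] an exponential this factorizes a moment generating function. *)
Lemma integral_iid_prod P m (phi : T -> R) :
  measurable_fun setT phi -> (forall z, 0 <= phi z) ->
  (\int[iid P m]_S (\prod_(i < m) phi (tnth S i))%:E =
   (\int[P]_z (phi z)%:E) ^+ m)%E.
Proof.
move=> mphi phi0.
have mprod k : measurable_fun setT
    (fun S : k.-tuple T => \prod_(i < k) phi (tnth S i)).
  by apply: measurable_prod => i _; exact: measurable_tnth_comp.
have prod0 k (S : k.-tuple T) : 0 <= \prod_(i < k) phi (tnth S i).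
  by rewrite prodr_ge0.
elim: m => [|m IH].
  rewrite /= integral_dirac//; last by apply/measurable_EFinP; exact: mprod.
  by rewrite diracT mul1e big_ord0.
rewrite expeS -IH /= ge0_integral_pushforward//; last 2 first.
- by apply/measurable_EFinP; exact: mprod.
- by move=> y _; rewrite lee_fin; exact: (prod0 m.+1).
rewrite preimage_setT fubini_tonelli1//=; last 2 first.
- apply/measurable_EFinP; apply: (measurableT_comp (mprod m.+1)).
  exact: measurable_tuple_cons.
- by move=> x; rewrite lee_fin; exact: (prod0 m.+1).
rewrite /fubini_F/=.
transitivity (\int[P]_x ((phi x)%:E *
    \int[iid P m]_S (\prod_(i < m) phi (tnth S i))%:E))%E.
  apply: eq_integral => x _; rewrite -ge0_integralZl//; last 3 first.
  - by apply/measurable_EFinP; exact: mprod.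
  - by move=> y _; rewrite lee_fin.
  - by rewrite lee_fin.
  apply: eq_integral => y _; rewrite -EFinM big_ord_recl; congr (_ * _)%:E.
  by apply: eq_bigr => i _; rewrite tnthS.
rewrite ge0_integralZr//.
- by apply/measurable_EFinP.
- by move=> y _; rewrite lee_fin.
- by apply: integral_ge0 => y _; rewrite lee_fin.
Qed.

(** From exp(-x) >= 1 - x one gets exp(x) <= 1 / (1 - x); the quadratic dominates this because its
    product with 1 - x is 1 + x^2 (1 - 2x) >= 1. *)
Lemma expR_le_quadratic (x : R) : x <= 2^-1 -> expR x <= 1 + x + 2 * x ^+ 2.
Proof.
move=> x2.
have h := expR_ge1Dx (- x).
have x1 : 0 < 1 - x by lra.
have : expR x <= (1 - x)^-1.
  by rewrite -[expR x]invrK -expRN lef_pV2 ?posrE ?expR_gt0.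
move=> /le_trans; apply.
rewrite -[leLHS]mul1r ler_pdivrMr//.
have -> : (1 + x + 2 * x ^+ 2) * (1 - x) = 1 + x ^+ 2 * (1 - 2 * x) by ring.
by rewrite lerDl mulr_ge0 ?sqr_ge0//; lra.
Qed.

Lemma bounded_integrable P (f : T -> R) (M : R) :
  measurable_fun setT f -> (forall z, `|f z| <= M) ->
  P.-integrable setT (EFin \o f).
Proof.
move=> mf f1; apply: measurable_bounded_integrable => //.
  by apply: (le_lt_trans (probability_le1 P measurableT)); rewrite ltry.
exists M; split; first exact: num_real.
by move=> x Mx z _; exact: (le_trans (f1 z) (ltW Mx)).
Qed.

(** A weak form of Hoeffding's lemma: integrating the quadratic bound removes the linear term
    because [Y] is centered, and 1 + 2 s^2 <= exp(2 s^2). *)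
Lemma mgf_centered_le P (Y : T -> R) (s : R) : measurable_fun setT Y ->
  (forall z, `|Y z| <= 1) -> \int[P]_z Y z = 0 -> 0 <= s <= 2^-1 ->
  (\int[P]_z (expR (s * Y z))%:E <= (expR (2 * s ^+ 2))%:E)%E.
Proof.
move=> mY Y1 Y0 /andP[s0 s2].
have iY := bounded_integrable P mY Y1.
have mq : measurable_fun setT (fun z => 1 + s * Y z + 2 * s ^+ 2).
  by do 2 (apply: measurable_funD => //); exact: measurable_funM.
have bound z : expR (s * Y z) <= 1 + s * Y z + 2 * s ^+ 2.
  have := Y1 z; rewrite ler_norml => /andP[Y1l Y1r].
  apply: (le_trans (expR_le_quadratic _)).
    by rewrite (le_trans _ s2)// ler_piMr.
  rewrite lerD2l ler_pM2l// exprMn ler_piMr ?sqr_ge0//.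
  by rewrite -(real_normK (num_real _)) exprn_ile1.
apply: (@le_trans _ _ (\int[P]_z (1 + s * Y z + 2 * s ^+ 2)%:E)%E).
  apply: ge0_le_integral => //.
  - apply/measurable_EFinP; apply: measurableT_comp => //.
    exact: measurable_funM.
  - by apply/measurable_EFinP.
  - by move=> z _; rewrite lee_fin.
have isY : P.-integrable setT (EFin \o (fun z => s * Y z)).
  apply: (@bounded_integrable P _ s); first exact: measurable_funM.
  by move=> z; rewrite normrM ger0_norm// ler_piMr.
have ic (k : R) : P.-integrable setT (EFin \o (fun=> k)).
  by apply: (@bounded_integrable P _ `|k|).
have -> : (\int[P]_z (1 + s * Y z + 2 * s ^+ 2)%:E =
          (\int[P]_z (1 + s * Y z + 2 * s ^+ 2))%:E)%E.
  rewrite /Rintegral fineK//.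
  apply: integrable_fin_num => //.
  apply: (@bounded_integrable P _ (1 + s + 2 * s ^+ 2)) => // z.
  rewrite (le_trans (ler_normD _ _))// lerD//; last first.
    by rewrite ger0_norm// mulr_ge0// sqr_ge0.
  rewrite (le_trans (ler_normD _ _))// lerD// ?normr1//.
  by rewrite normrM ger0_norm// ler_piMr.
rewrite lee_fin RintegralD//; last first.
  by apply: (@integrableD _ _ _ P _ _ _ _ (ic 1) isY).
rewrite RintegralD// RintegralZl// Y0 mulr0 !Rintegral_cst//.
rewrite /= probability_setT /= !mulr1 addr0.
exact: expR_ge1Dx.
Qed.

Lemma iid_upper_deviation P m (Y : T -> R) (e : R) : measurable_fun setT Y ->
  (forall z, `|Y z| <= 1) -> \int[P]_z Y z = 0 -> 0 < e <= 1 ->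
  (iid P m [set S | (m%:R * e <= \sum_(i < m) Y (tnth S i))%R]
   <= (expR (- (m%:R * (e ^+ 2 / 8))))%:E)%E.
Proof.
move=> mY Y1 Y0 /andP[e0 e1].
have mS : measurable_fun setT (fun S : m.-tuple T => \sum_(i < m) Y (tnth S i)).
  by apply: measurable_sum => i; exact: measurable_tnth_comp.
pose SM := mfun_Sub (mem_set mS : (_ \in mfun)).
(* The Chernoff parameter e / 4 minimizes 2 s^2 - s e, with minimum - e^2 / 8. It stays below 1/2
   because e <= 1. *)
have s0 : 0 < e / 4 by rewrite divr_gt0.
have := chernoff (P := iid P m) SM (m%:R * e) s0.
move=> /le_trans; apply.
have -> : expR (- (m%:R * (e ^+ 2 / 8))) =
    expR (2 * (e / 4) ^+ 2) ^+ m * expR (- (e / 4 * (m%:R * e))).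
  rewrite -expRM_natl -expRD; congr expR.
  by field.
rewrite EFinM lee_pmul2r// ?lte_fin ?expR_gt0//.
rewrite /mmt_gen_fun unlock /=.
under eq_integral => S _.
  rewrite /= mulr_suml expR_sum.
  over.
rewrite /=.
under eq_integral do under eq_bigr do rewrite mulrC.
rewrite (integral_iid_prod _ _ (phi := fun z => expR (e / 4 * Y z)))//;
  last first.
  apply: measurableT_comp => //; exact: measurable_funM.
set I := (\int[P]_z _)%E.
have I0 : (0 <= I)%E by apply: integral_ge0 => z _; rewrite lee_fin expR_ge0.
have I1 : (I <= (expR (2 * (e / 4) ^+ 2))%:E)%E.
  by apply: mgf_centered_le => //; apply/andP; split; lra.
have If : I \is a fin_num by rewrite ge0_fin_numE// (le_lt_trans I1)// ltry.
move: I0 I1; rewrite -(fineK If) -EFin_expe !lee_fin => I0 I1.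
by rewrite lerXn2r// nnegrE ?expR_ge0.
Qed.

Lemma iid_deviation P m (g : T -> R) (e : R) : measurable_fun setT g ->
  (forall z, 0 <= g z <= 1) -> 0 < e <= 1 ->
  (iid P m [set S | (m%:R * e <=
     `|\sum_(i < m) (g (tnth S i) - \int[P]_z g z)|)%R]
   <= (2 * expR (- (m%:R * (e ^+ 2 / 8))))%:E)%E.
Proof.
move=> mg g01 e01; set c := \int[P]_z g z.
have ig : P.-integrable setT (EFin \o g).
  apply: (@bounded_integrable P _ 1) => // z.
  by have /andP[g0 g1] := g01 z; rewrite ger0_norm.
have ic (k : R) : P.-integrable setT (EFin \o (fun=> k)).
  by apply: (@bounded_integrable P _ `|k|).
have cst (k : R) : \int[P]_z k = k.
  by rewrite Rintegral_cst//= probability_setT /= mulr1.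
have c01 : 0 <= c <= 1.
  apply/andP; split.
    by apply: Rintegral_ge0 => z _; case/andP: (g01 z).
  rewrite -[leRHS]cst; apply: le_Rintegral => //.
  by move=> z _; case/andP: (g01 z).
pose Y z := g z - c.
have mY : measurable_fun setT Y by apply: measurable_funB.
have Y1 z : `|Y z| <= 1.
  by rewrite /Y ler_norml; have := g01 z; move: c01; lra.
have Y0 : \int[P]_z Y z = 0 by rewrite RintegralB// cst subrr.
have mN : measurable_fun setT (fun z => - Y z) by exact: measurable_funN.
have N1 z : `|- Y z| <= 1 by rewrite normrN.
have N0 : \int[P]_z - Y z = 0.
  under eq_Rintegral do rewrite -mulN1r.
  by rewrite RintegralZl ?Y0 ?mulr0//; apply: (@bounded_integrable P _ 1).
have dev (Z : T -> R) : measurable_fun setT Z ->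
    measurable [set S : m.-tuple T | (m%:R * e <= \sum_(i < m) Z (tnth S i))%R].
  move=> mZ.
  have mS : measurable_fun setT
      (fun S : m.-tuple T => \sum_(i < m) Z (tnth S i)).
    by apply: measurable_sum => i; exact: measurable_tnth_comp.
  have := mS measurableT `[m%:R * e, +oo[%classic (measurable_itv _).
  by rewrite setTI; congr measurable; apply/seteqP; split => S /=;
    rewrite in_itv/= andbT.
(* The two-sided event is the union of the upper tails of [Y] and of its opposite, whence the factor
   2. *)
have -> : [set S : m.-tuple T |
      (m%:R * e <= `|\sum_(i < m) (g (tnth S i) - c)|)%R] =
    [set S | (m%:R * e <= \sum_(i < m) Y (tnth S i))%R] `|`
    [set S | (m%:R * e <= \sum_(i < m) - Y (tnth S i))%R].
  apply/seteqP; split => S /=; rewrite sumrN -/(Y _) ler_normr.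
    by move/orP.
  by move=> h; apply/orP.
apply: (le_trans (measureU2 _ (dev _ mY) (dev _ mN))).
rewrite [2 * _]mulr_natl mulr2n EFinD.
have dY := iid_upper_deviation m mY Y1 Y0 e01.
have dN := iid_upper_deviation m mN N1 N0 e01.
exact: leeD dY dN.
Qed.

End IidMoments.

Lemma probability_finite_union_le (R : realType) d (T : measurableType d)
    (P : probability T R) (I : Type) (r : seq I) (F : I -> set T) (p : \bar R) :
  (forall i, measurable (F i)) -> (forall i, P (F i) <= p)%E ->
  (P (\big[setU/set0]_(i <- r) F i) <= (size r)%:R%:E * p)%E.
Proof.
move=> mF Fp.
elim: r => [|i r IH]; first by rewrite big_nil measure0 mul0e.
rewrite big_cons (le_trans (measureU2 _ _ _))//.
  exact: bigsetU_measurable.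
rewrite /= -natr1 EFinD ge0_muleDl ?lee_fin// mul1e addeC leeD//.
Qed.

(** * Empirical risk minimization over a finitely covered class *)

Section FiniteCover.
Context (R : realType) d d' (X : measurableType d) (Y : measurableType d').
Variables (loss : Y -> Y -> R) (E : set (X -> Y)) (I : finType).
Variables (g : I -> X * Y -> R) (eps : R).
Hypothesis eps01 : 0 < eps < 1.
Hypothesis measurable_g : forall i, measurable_fun setT (g i).
Hypothesis g01 : forall i z, 0 <= g i z <= 1.
Hypothesis measurable_loss : forall f, E f ->
  measurable_fun setT (fun z : X * Y => loss z.2 (f z.1)).
Hypothesis loss01 : forall y1 y2, 0 <= loss y1 y2 <= 1.
(** The approximation is uniform in [z], so a single index serves the risk under any [P] and the
    empirical risk of any sample. *)
Hypothesis cover : forall f, E f ->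
  exists i, forall z, `|loss z.2 (f z.1) - g i z| <= eps / 8.

Lemma cover_risk (P : probability (X * Y)%type R) f i : E f ->
  (forall z, `|loss z.2 (f z.1) - g i z| <= eps / 8) ->
  `|risk loss P f - \int[P]_z g i z| <= eps / 8.
Proof.
move=> Ef fi.
have cst (k : R) : \int[P]_z k = k.
  by rewrite Rintegral_cst//= probability_setT /= mulr1.
have ic (k : R) : P.-integrable setT (EFin \o (fun=> k)).
  by apply: (@bounded_integrable _ _ _ P _ `|k|).
have mf := measurable_loss Ef.
have il : P.-integrable setT (EFin \o (fun z => loss z.2 (f z.1))).
  apply: (@bounded_integrable _ _ _ P _ 1) => // z.
  by have /andP[l0 l1] := loss01 z.2 (f z.1); rewrite ger0_norm.
have ig : P.-integrable setT (EFin \o g i).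
  apply: (@bounded_integrable _ _ _ P _ 1) => // z.
  by have /andP[l0 l1] := g01 i z; rewrite ger0_norm.
rewrite /risk -RintegralB//.
have md : measurable_fun setT (fun z : X * Y => loss z.2 (f z.1) - g i z).
  exact: measurable_funB.
have id : P.-integrable setT (EFin \o (fun z => loss z.2 (f z.1) - g i z)).
  exact: (@bounded_integrable _ _ _ P _ (eps / 8)).
apply: (le_trans (le_normr_Rintegral measurableT id)).
rewrite -[leRHS]cst; apply: le_Rintegral => //.
apply: (@bounded_integrable _ _ _ P _ (eps / 8)).
  exact: measurableT_comp.
by move=> z; rewrite normr_id.
Qed.

Lemma cover_empirical_risk m (S : m.-tuple (X * Y)) f i : (0 < m)%N ->
  (forall z, `|loss z.2 (f z.1) - g i z| <= eps / 8) ->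
  `|empirical_risk loss S f - m%:R^-1 * \sum_(j < m) g i (tnth S j)| <= eps / 8.
Proof.
move=> m0 fi; rewrite /empirical_risk -mulrBr -sumrB normrM ger0_norm//.
rewrite ler_pdivrMl ?ltr0n//.
rewrite (le_trans (ler_norm_sum _ _ _))//.
rewrite (le_trans (ler_sum _ (G := fun=> eps / 8) _))//.
by rewrite sumr_const card_ord mulr_natl.
Qed.

(** Outside the union of the bad events, risk and empirical risk differ by at most eps/8 + eps/4 +
    eps/8 = eps/2, for the empirical minimizer and for [h] alike. Since the empirical risk of the
    former is at most that of [h], the excess risk is at most eps. Deviations of size eps/4 give the
    exponent (eps/4)^2 / 8 = eps^2 / 128. *)
Lemma pac_of_finite_cover (P : probability (X * Y)%type R) m (delta : R)
    (hhat : m.-tuple (X * Y) -> X -> Y) (h : X -> Y) :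
  (#|I|)%:R * (2 * expR (- (m%:R * (eps ^+ 2 / 128)))) <= delta ->
  (forall S, is_argmin E (empirical_risk loss S) (hhat S)) ->
  is_argmin E (risk loss P) h ->
  ((1 - delta)%:E <= inner_prob (iid P m)
     [set S | (risk loss P (hhat S) - risk loss P h <= eps)%R])%E.
Proof.
move=> hdelta hhatP [Eh hP].
have e4 : 0 < eps / 4 <= 1 by move: eps01; lra.
pose bad i := [set S : m.-tuple (X * Y) | (m%:R * (eps / 4) <=
     `|\sum_(j < m) (g i (tnth S j) - \int[P]_z g i z)|)%R].
have mbad i : measurable (bad i).
  have mS : measurable_fun setT (fun S : m.-tuple (X * Y) =>
      `|\sum_(j < m) (g i (tnth S j) - \int[P]_z g i z)|).
    apply: measurableT_comp => //.
    apply: measurable_sum => j; apply: measurable_funB => //.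
    exact: measurable_tnth_comp.
  have := mS measurableT `[m%:R * (eps / 4), +oo[%classic (measurable_itv _).
  by rewrite setTI; congr measurable; apply/seteqP; split => S /=;
    rewrite in_itv/= andbT.
pose U := \big[setU/set0]_(i <- enum I) bad i.
have mU : measurable U by apply: bigsetU_measurable.
have PU : (iid P m U <= delta%:E)%E.
  apply: le_trans (probability_finite_union_le _ mbad
    (p := (2 * expR (- (m%:R * (eps ^+ 2 / 128))))%:E) _) _.
    move=> i; have := iid_deviation P m (measurable_g i) (g01 i) e4.
    rewrite (_ : (eps / 4) ^+ 2 / 8 = eps ^+ 2 / 128)//.
    by field.
  by rewrite -cardE -EFinM lee_fin.
(* The complement of [U] is a measurable subset of the success event, which is all that bounding an
   inner probability from below requires. *)
apply: (@le_trans _ _ (iid P m (~` U))).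
  rewrite probability_setC// EFinB leeB//.
apply: ereal_sup_ubound; exists (~` U) => //; split; first exact: measurableC.
move=> S /= US.
have good i : `|\sum_(j < m) (g i (tnth S j) - \int[P]_z g i z)|
    < m%:R * (eps / 4).
  rewrite ltNge; apply/negP => Si; apply: US.
  by rewrite /U -bigcup_seq; exists i => //=; rewrite mem_enum.
have [f [Ef fmin]] : exists f, E f /\ (forall f', E f' ->
    empirical_risk loss S f <= empirical_risk loss S f') /\ f = hhat S.
  by have [Ef fm] := hhatP S; exists (hhat S).
move: fmin => [fmin <-].
have [i fi] := cover Ef.
have [j hj] := cover Eh.
(* For m = 0 the strict inequality [good i] would read 0 < 0, so the empty sample lies in every bad
   event. *)
have m0 : (0 < m)%N.
  have := le_lt_trans (normr_ge0 _) (good i).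
  by rewrite pmulr_lgt0 ?ltr0n//; move: eps01; lra.
have close k : `|m%:R^-1 * (\sum_(l < m) g k (tnth S l)) - \int[P]_z g k z|
    <= eps / 4.
  rewrite (_ : _ - _ = m%:R^-1 *
    \sum_(l < m) (g k (tnth S l) - \int[P]_z g k z)); last first.
    rewrite sumrB mulrBr sumr_const card_ord.
    rewrite -[in RHS](mulr_natl (Rintegral _ _ _)) mulKf//.
    by rewrite pnatr_eq0 -lt0n.
  by rewrite normrM ger0_norm// ler_pdivrMl ?ltr0n// ltW.
have := cover_risk P Ef fi; have := cover_risk P Eh hj.
have := cover_empirical_risk S m0 fi; have := cover_empirical_risk S m0 hj.
have := close i; have := close j; have := fmin _ Eh.
rewrite !ler_norml; lra.
Qed.

End FiniteCover.

(** * The trace distance of pure states *)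

(** Each [d i] is 0 or [t], hence equals sqrt(d i) sqrt(t); dividing the sum of the [d i] by sqrt(t)
    gives the claim without counting multiplicities. *)
Lemma sum_sqrt_quadratic_roots (C : numClosedFieldType) (I : finType)
    (d : I -> C) (t : C) : 0 <= t -> (forall i, d i ^+ 2 = t * d i) ->
  \sum_i d i = 2 * t -> \sum_i sqrtC (d i) = 2 * sqrtC t.
Proof.
move=> t0 dE sumd.
have sd i : sqrtC (d i) * sqrtC t = d i.
  have /eqP := dE i; rewrite expr2 -subr_eq0 -mulrBl mulf_eq0 subr_eq0.
  by case/orP => /eqP ->; rewrite ?sqrtC0 ?mul0r// -expr2 sqrtCK.
have [t00|tN0] := eqVneq t 0.
  rewrite t00 sqrtC0 mulr0; apply: big1 => i _.
  by have := sd i; rewrite t00 sqrtC0 mulr0 => <-; rewrite sqrtC0.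
have st0 : sqrtC t != 0 by rewrite sqrtC_eq0.
apply: (mulIf st0); rewrite -mulrA -expr2 sqrtCK -sumd mulr_suml.
exact: eq_bigr.
Qed.

Lemma diag_similar (C : numClosedFieldType) (N : nat) (M : 'M[C]_N) :
  M \is hermsymmx ->
  invmx (spectralmx M) *m diag_mx (spectral_diag M) *m spectralmx M = M.
Proof.
by move=> Mh; rewrite -(orthomx_spectralP (hermitian_normalmx Mh)).
Qed.

(* [H^2 = t H] leaves [0] and [t] as the only possible eigenvalues of [H]. *)
Lemma trace_mxsqrt (C : numClosedFieldType) (N : nat) (H : 'M[C]_N) (t : C) :
  H \is hermsymmx -> 0 <= t -> H *m H = t *: H -> \tr H = 2 * t ->
  \tr (mxsqrt H) = 2 * sqrtC t.
Proof.
move=> Hh t0 HH trH.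
have HE := diag_similar Hh.
set P := spectralmx H in HE *; set D := spectral_diag H in HE *.
have Pu : P \in unitmx by exact: spectral_unit.
have DE : diag_mx D = P *m H *m invmx P.
  by rewrite -[in RHS]HE !mulmxA mulmxV// mul1mx mulmxK.
rewrite /mxsqrt -/P -/D mxtrace_mulC mulmxA mulmxV// mul1mx.
rewrite mxtrace_diag.
under eq_bigr do rewrite mxE.
apply: sum_sqrt_quadratic_roots => //.
- move=> i.
  have DD : diag_mx D *m diag_mx D = t *: diag_mx D.
    rewrite DE !mulmxA mulmxKV// -(mulmxA P H H) HH.
    by rewrite -scalemxAr -!scalemxAl.
  have := congr1 (fun A : 'M[C]_N => A i i) DD.
  by rewrite mul_diag_mx !mxE eqxx mulr1n expr2.
- by rewrite -mxtrace_diag DE mxtrace_mulC mulmxA mulVmx// mul1mx trH.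
Qed.

Lemma adjoint_mul (C : numClosedFieldType) m n p (A : 'M[C]_(m, n))
    (B : 'M[C]_(n, p)) : (A *m B)^t* = B^t* *m A^t*.
Proof. by rewrite trmx_mul map_mxM. Qed.

Section PureDifference.
Variables (C : numClosedFieldType) (N : nat) (u v : 'cV[C]_N).
Hypothesis u1 : u^t* *m u = 1%:M.
Hypothesis v1 : v^t* *m v = 1%:M.
Let s := (u^t* *m v) 0 0.
Let t := 1 - s * s^*.
Let M := u *m u^t* - v *m v^t*.

Let uv : u^t* *m v = s%:M. Proof. exact: mx11_scalar. Qed.
Let vu : v^t* *m u = (s^*)%:M.
Proof.
have <- : (u^t* *m v)^t* = v^t* *m u by rewrite adjoint_mul trmxCK.
by rewrite uv tr_scalar_mx map_scalar_mx.
Qed.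

Lemma pure_difference_adjoint : M^t* = M.
Proof. by rewrite /M linearB/= map_mxB !adjoint_mul !trmxCK. Qed.

Lemma pure_difference_sqr :
  M *m M = u *m u^t* + v *m v^t* - s *: (u *m v^t*) - s^* *: (v *m u^t*).
Proof.
rewrite /M mulmxBr !mulmxBl !mulmxA.
rewrite -(mulmxA u _ u) u1 -(mulmxA v _ v) v1 -(mulmxA u _ v) uv.
rewrite -(mulmxA v _ u) vu !mulmx1 !mul_mx_scalar -!scalemxAl.
by rewrite opprB addrACA addrA addrAC.
Qed.

Lemma pure_difference_tr_sqr : \tr (M *m M) = 2 * t.
Proof.
rewrite pure_difference_sqr !raddfB raddfD/= !mxtraceZ.
rewrite ![\tr (_ *m _^t*)]mxtrace_mulC u1 v1 uv vu.
rewrite !mxtrace_scalar !mulr1n /t; ring.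
Qed.

(** The square of [M] acts as the scalar [t] on both [u] and [v], whose span contains the range of
    [M]. *)
Lemma pure_difference_cube : M *m M *m M = t *: M.
Proof.
have Mu : M *m u = u - s^* *: v.
  by rewrite /M mulmxBl -!mulmxA u1 vu mulmx1 mul_mx_scalar.
have Mv : M *m v = s *: u - v.
  by rewrite /M mulmxBl -!mulmxA v1 uv mulmx1 mul_mx_scalar.
have MMu : M *m M *m u = t *: u.
  rewrite -mulmxA Mu mulmxBr -scalemxAr Mu Mv scalerBr scalerA.
  by rewrite opprB addrA subrK /t scalerBl scale1r [s * _]mulrC.
have MMv : M *m M *m v = t *: v.
  rewrite -mulmxA Mv mulmxBr -scalemxAr Mu Mv scalerBr scalerA.
  by rewrite opprB addrC addrA addrNK /t scalerBl scale1r.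
transitivity (M *m M *m (u *m u^t* - v *m v^t*)); first by [].
by rewrite mulmxBr !mulmxA MMu MMv -!scalemxAl -scalerBr.
Qed.

(** Here [t] is the Gram determinant of [u] and [v], so this is Cauchy-Schwarz; it follows from 2t
    being the trace of the positive semidefinite matrix M^2. *)
Lemma pure_difference_det_ge0 : 0 <= t.
Proof.
have : 0 <= \tr (M *m M).
  rewrite -{1}pure_difference_adjoint /mxtrace sumr_ge0// => i _.
  rewrite mxE sumr_ge0// => j _.
  by rewrite !mxE mulrC mul_conjC_ge0.
by rewrite pure_difference_tr_sqr pmulr_rge0.
Qed.

(** As [M] is self-adjoint, the matrix under the root is H = M^2, and M^3 = t M yields H^2 = t H. *)
Lemma tr_mxsqrt_pure_difference : \tr (mxsqrt (M^t* *m M)) = 2 * sqrtC t.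
Proof.
rewrite pure_difference_adjoint; apply: trace_mxsqrt.
- apply/is_hermitianmxP.
  by rewrite expr0 scale1r adjoint_mul pure_difference_adjoint.
- exact: pure_difference_det_ge0.
- by rewrite mulmxA pure_difference_cube -scalemxAl.
- exact: pure_difference_tr_sqr.
Qed.

End PureDifference.

Section OverlapLoss.
Variable R : realType.

(** The squared modulus as an element of [R], since the norm of [R[i]] takes its values in
    [R[i]]. *)
Definition sqnormc (z : R[i]) : R := complex.Re z ^+ 2 + complex.Im z ^+ 2.

Lemma sqnormcE (z : R[i]) : real_complex R (sqnormc z) = `|z| ^+ 2.
Proof. exact: add_Re2_Im2. Qed.

Lemma sqrtC_real_complex (r : R) : 0 <= r ->
  sqrtC (real_complex R r) = real_complex R (Num.sqrt r).
Proof.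
move=> r0; rewrite -[in LHS](sqr_sqrtr r0) rmorphXn /= sqrCK//.
by rewrite ler0c sqrtr_ge0.
Qed.

Definition overlap N (u v : 'cV[R[i]]_N) : R[i] := (u^t* *m v) 0 0.

Definition overlap_loss N (u v : 'cV[R[i]]_N) : R :=
  Num.sqrt (1 - sqnormc (overlap u v)).

Lemma trace_norm_pure_difference N (u v : 'cV[R[i]]_N) :
  u^t* *m u = 1%:M -> v^t* *m v = 1%:M ->
  2^-1 * trace_norm (u *m u^t* - v *m v^t*) = overlap_loss u v.
Proof.
move=> u1 v1; rewrite /trace_norm tr_mxsqrt_pure_difference//.
have := pure_difference_det_ge0 u1 v1.
rewrite -normCK -/(overlap u v) -sqnormcE.
rewrite -[1]/(real_complex R 1) -rmorphB /= ler0c => t0.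
rewrite sqrtC_real_complex//.
have -> : (2 : R[i]) = real_complex R 2 by rewrite rmorph_nat.
by rewrite -rmorphM /= mulKf.
Qed.

Lemma overlap_loss_phase n (u v w : 'cV[R[i]]_(qdim n)) :
  phase_eq v w -> overlap_loss u v = overlap_loss u w.
Proof.
case=> z z1 ->; rewrite /overlap_loss /overlap -scalemxAr mxE.
congr (Num.sqrt (1 - _)); apply: (@complexI R).
by rewrite !sqnormcE normrM z1 mul1r.
Qed.

Lemma overlap_loss01 N (u v : 'cV[R[i]]_N) : 0 <= overlap_loss u v <= 1.
Proof.
rewrite /overlap_loss sqrtr_ge0 /= -[leRHS]sqrtr1 ler_sqrt ?ler01//.
by rewrite lerBlDr lerDl addr_ge0// sqr_ge0.
Qed.

Variable n : nat.

Lemma ket_unit (x : pure_state R n) : (ket x)^t* *m ket x = 1%:M.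
Proof.
apply/matrixP => i j; rewrite !ord1 !mxE eqxx mulr1n.
rewrite /ket; set v := repr _; have /eqP <- := valP v.
by apply: eq_bigr => k _; rewrite !mxE mulrC -normCK.
Qed.

Lemma trace_loss_overlap (x y w : pure_state R n) (C : 'M[R[i]]_(qdim n)) :
  phase_eq (ket w) (C *m ket x) ->
  trace_loss y w = overlap_loss (ket y) (C *m ket x).
Proof.
move=> wx; rewrite /trace_loss trace_norm_pure_difference ?ket_unit//.
exact: overlap_loss_phase.
Qed.

Lemma trace_loss01 (y w : pure_state R n) : 0 <= trace_loss y w <= 1.
Proof.
by rewrite /trace_loss trace_norm_pure_difference ?ket_unit// overlap_loss01.
Qed.

(** * Continuity and measurability of the overlap loss *)

Lemma normc_ge_Im (z : R[i]) : real_complex R `|complex.Im z| <= `|z|.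
Proof.
rewrite -[complex.Im z]opprK -ReiNIm normrN (le_trans (normc_ge_Re _))//.
rewrite normrM (_ : `|'i%C| = 1) ?mulr1//.
by rewrite normc_def /= expr0n expr1n add0r sqrtr1.
Qed.

Lemma contraction_continuous (f : R[i]^o -> R) :
  (forall x y, f x - f y = f (x - y)) ->
  (forall x, real_complex R `|f x| <= `|x|) -> continuous f.
Proof.
move=> fB f1 x A /nbhs_ballP[e /= e0 eA].
(* Radii of balls in [R[i]^o] are themselves elements of [R[i]], so the real radius has to be
   embedded. *)
apply/(@nbhs_ballP R[i] R[i]^o); exists (real_complex R e) => /=.
  by rewrite ltcR.
move=> t xt; apply: eA; rewrite /ball /= -ltcR fB.
exact: le_lt_trans (f1 _) xt.
Qed.

Lemma Re_continuous : continuous (@complex.Re R : R[i]^o -> R).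
Proof.
by apply: contraction_continuous => [[? ?] [? ?]//|]; exact: normc_ge_Re.
Qed.

Lemma Im_continuous : continuous (@complex.Im R : R[i]^o -> R).
Proof.
by apply: contraction_continuous => [[? ?] [? ?]//|]; exact: normc_ge_Im.
Qed.

(** Entries of the projector |v><v|. Unlike the coordinates of [v] they are invariant under phases,
    so they are functions of the state. *)
Definition density (v : 'cV[R[i]]_(qdim n)) k l : R[i] := v k 0 * (v l 0)^*.

Lemma coordinate_continuous k : continuous
  (fun v : unit_vector R n => (val v : 'cV[R[i]]_(qdim n)) k 0 : R[i]^o).
Proof.
move=> v; apply: (@continuous_comp _ _ _
  (fun v : unit_vector R n => val v : 'cV[R[i]^o : topologicalType]_(qdim n))
  (fun M : 'cV[R[i]^o : topologicalType]_(qdim n) => M k 0 : R[i]^o)).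
  exact: initial_continuous.
exact: (@coord_continuous R[i]).
Qed.

Lemma density_continuous k l :
  continuous (fun v : unit_vector R n => complex.Re (density (val v) k l)) /\
  continuous (fun v : unit_vector R n => complex.Im (density (val v) k l)).
Proof.
pose re k (v : unit_vector R n) : R := complex.Re ((val v : 'cV_(qdim n)) k 0).
pose im k (v : unit_vector R n) : R := complex.Im ((val v : 'cV_(qdim n)) k 0).
have cre j : continuous (re j).
  move=> v; apply: (@continuous_comp _ _ _
    (fun v : unit_vector R n => (val v : 'cV[R[i]]_(qdim n)) j 0 : R[i]^o)
    (@complex.Re R : R[i]^o -> R)).
    exact: coordinate_continuous.
  exact: Re_continuous.
have cim j : continuous (im j).
  move=> v; apply: (@continuous_comp _ _ _
    (fun v : unit_vector R n => (val v : 'cV[R[i]]_(qdim n)) j 0 : R[i]^o)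
    (@complex.Im R : R[i]^o -> R)).
    exact: coordinate_continuous.
  exact: Im_continuous.
split.
- rewrite (_ : (fun v => _) = (re k \* re l) \+ (im k \* im l)).
    move=> v; apply: continuousD; apply: continuousM;
      by [exact: cre | exact: cim].
  apply/funext => v; rewrite /density /= /re /im.
  by case: (_ k 0) => a b; case: (_ l 0) => c d /=; ring.
- rewrite (_ : (fun v => _) = (im k \* re l) \- (re k \* im l)).
    move=> v; apply: continuousB; apply: continuousM;
      by [exact: cre | exact: cim].
  apply/funext => v; rewrite /density /= /re /im.
  by case: (_ k 0) => a b; case: (_ l 0) => c d /=; ring.
Qed.

Lemma density_phase k l (u v : 'cV[R[i]]_(qdim n)) :
  phase_eq u v -> density u k l = density v k l.
Proof.
case=> z z1 ->; rewrite /density !mxE rmorphM mulrACA -normCK z1 expr1n.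
by rewrite mul1r.
Qed.

(** The choice of representatives made by [ket] need not be continuous, but a continuous
    phase-invariant function descends to a continuous function on the quotient, and open sets of the
    quotient generate the sigma-algebra of [pure_state]. *)
Lemma phase_invariant_measurable (F : 'cV[R[i]]_(qdim n) -> R) :
  continuous (fun v : unit_vector R n => F (val v)) ->
  (forall u v, phase_eq u v -> F u = F v) ->
  measurable_fun setT (fun x : pure_state R n => F (ket x)).
Proof.
move=> cF pF.
have cG : continuous (fun x : state_space R n =>
    F (val (repr (x : {eq_quot (same_state_equiv R n)})))).
  apply: (@repr_comp_continuous _ _ _
    (fun v : unit_vector R n => F (val v))) => //.
  move=> u v /eqP uv; apply/eqP; apply: pF.
  by move/eqmodP : uv => /asboolP.
apply: (@measurability _ _ (pure_state R n) R _ _ _ (RGenOpens.measurableE R)).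
move=> _ [_ [a [b ->]] <-]; rewrite setTI; apply: sub_sigma_algebra.
by move/continuousP : cG; apply; exact: interval_open.
Qed.

Section ComplexMeasurable.
Context d (T : measurableType d).
Implicit Types f g : T -> R[i].

Definition complex_measurable f :=
  measurable_fun setT (fun x => complex.Re (f x)) /\
  measurable_fun setT (fun x => complex.Im (f x)).

Lemma complex_measurable_cst (c : R[i]) : complex_measurable (fun=> c).
Proof. by split; exact: measurable_cst. Qed.

Lemma complex_measurableM f g : complex_measurable f -> complex_measurable g ->
  complex_measurable (fun x => f x * g x).
Proof.
move=> [fr fi] [gr gi]; split.
- apply: (eq_measurable_fun ((fun x => complex.Re (f x) * complex.Re (g x)) \-
      (fun x => complex.Im (f x) * complex.Im (g x)))).
    by move=> x _ /=; case: (f x) (g x) => a b [? ?].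
  by apply: measurable_funB; exact: measurable_funM.
- apply: (eq_measurable_fun ((fun x => complex.Re (f x) * complex.Im (g x)) \+
      (fun x => complex.Im (f x) * complex.Re (g x)))).
    by move=> x _ /=; case: (f x) (g x) => a b [? ?].
  by apply: measurable_funD; exact: measurable_funM.
Qed.

Lemma complex_measurable_sum (I : Type) (r : seq I) (f : I -> T -> R[i]) :
  (forall i, complex_measurable (f i)) ->
  complex_measurable (fun x => \sum_(i <- r) f i x).
Proof.
move=> mf; elim: r => [|i r [IHr IHi]].
  by under eq_fun do rewrite big_nil; exact: complex_measurable_cst.
under eq_fun do rewrite big_cons.
have [fr fi] := mf i; split.
- apply: (eq_measurable_fun ((fun x => complex.Re (f i x)) \+
      (fun x => complex.Re (\sum_(j <- r) f j x)))).
    by move=> x _ /=; rewrite raddfD.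
  exact: measurable_funD.
- apply: (eq_measurable_fun ((fun x => complex.Im (f i x)) \+
      (fun x => complex.Im (\sum_(j <- r) f j x)))).
    by move=> x _ /=; rewrite raddfD.
  exact: measurable_funD.
Qed.

End ComplexMeasurable.

Lemma complex_measurable_comp d d' (T : measurableType d)
    (S : measurableType d') (h : S -> T) (f : T -> R[i]) :
  measurable_fun setT h -> complex_measurable f ->
  complex_measurable (fun x => f (h x)).
Proof.
move=> mh [fr fi]; split.
  exact: (measurableT_comp fr mh).
exact: (measurableT_comp fi mh).
Qed.

Lemma density_measurable k l :
  complex_measurable (fun x : pure_state R n => density (ket x) k l).
Proof.
have [cr ci] := density_continuous k l.
split.
- apply: (phase_invariant_measurable
    (F := fun v => complex.Re (density v k l)) cr) => u v /density_phase uv.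
  by rewrite uv.
- apply: (phase_invariant_measurable
    (F := fun v => complex.Im (density v k l)) ci) => u v /density_phase uv.
  by rewrite uv.
Qed.

(** This writes the squared overlap as a sum of products of a function of [x] alone and a function
    of [y] alone. Joint measurability for the product sigma-algebra then reduces to measurability on
    each factor. *)
Lemma sqr_overlap_density (C : 'M[R[i]]_(qdim n)) (x y : 'cV[R[i]]_(qdim n)) :
  let s := overlap y (C *m x) in
  s * s^* = \sum_i \sum_j \sum_k \sum_l
    C i j * (C k l)^* * density y k i * density x j l.
Proof.
have sE : overlap y (C *m x) = \sum_i \sum_j C i j * ((y i 0)^* * x j 0).
  rewrite /overlap mxE; apply: eq_bigr => i _.
  rewrite !mxE mulr_sumr; apply: eq_bigr => j _.
  by rewrite mulrCA.
rewrite /= sE rmorph_sum mulr_suml; apply: eq_bigr => i _.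
rewrite mulr_suml; apply: eq_bigr => j _.
rewrite mulr_sumr; apply: eq_bigr => k _.
rewrite rmorph_sum mulr_sumr; apply: eq_bigr => l _.
rewrite !rmorphM /= conjCK /density.
set a := (y i 0)^*; set b := (C k l)^*; set c := (x l 0)^*; ring.
Qed.

Lemma overlap_loss_measurable (C : 'M[R[i]]_(qdim n)) :
  measurable_fun setT (fun z : pure_state R n * pure_state R n =>
    overlap_loss (ket z.2) (C *m ket z.1)).
Proof.
apply: (measurableT_comp (f := @Num.sqrt R)).
  exact: continuous_measurable_fun (@sqrt_continuous R).
apply: measurable_funB => //.
pose F (z : pure_state R n * pure_state R n) : R[i] :=
  \sum_i \sum_j \sum_k \sum_l
    C i j * (C k l)^* * density (ket z.2) k i * density (ket z.1) j l.
have [mF _] : complex_measurable F.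
  apply: complex_measurable_sum => i; apply: complex_measurable_sum => j.
  apply: complex_measurable_sum => k; apply: complex_measurable_sum => l.
  apply: complex_measurableM.
    apply: complex_measurableM; first exact: complex_measurable_cst.
    exact: complex_measurable_comp measurable_snd (density_measurable k i).
  exact: complex_measurable_comp measurable_fst (density_measurable j l).
apply: (eq_measurable_fun (fun z => complex.Re (F z))) => // z _.
by rewrite /F -sqr_overlap_density -normCK -sqnormcE.
Qed.

End OverlapLoss.

(** * Rounding gates and circuits *)

Section UnitaryProducts.
Variables (C : numClosedFieldType) (N : nat).
Implicit Types (U V : 'M[C]_N) (eta : C).

Lemma unitary_entry_le1 U i j : U \is unitarymx -> `|U i j| <= 1.
Proof.
move=> /unitarymxP /(congr1 (fun M : 'M[C]_N => M i i)).
rewrite !mxE eqxx mulr1n (bigD1 j)//= !mxE -normCK => UE.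
rewrite -(@expr_le1 _ 2)// -UE lerDl sumr_ge0// => k _.
by rewrite !mxE -normCK exprn_ge0.
Qed.

Lemma unitary_prod g (G : 'I_g -> 'M[C]_N) :
  (forall i, G i \is unitarymx) -> \prod_(i < g) G i \is unitarymx.
Proof.
move=> GU; elim: g G GU => [|g IH] G GU.
  by rewrite big_ord0; apply/unitarymxP; rewrite trmx1 map_mx1 mulmx1.
by rewrite big_ord_recl; apply: mul_unitarymx => //; exact: IH.
Qed.

(** The entry is a sum of N^2 terms, each at most [eta]. The bound serves both to sandwich the error
    of a gate between unitaries and, with vectors for [A] and [B], to bound overlaps. *)
Lemma mulmx_entry_le p q (A : 'M[C]_(p, N)) (M : 'M[C]_N) (B : 'M[C]_(N, q))
    eta i j :
  (forall a, `|A i a| <= 1) -> (forall a b, `|M a b| <= eta) ->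
  (forall b, `|B b j| <= 1) ->
  `|(A *m M *m B) i j| <= (N ^ 2)%:R * eta.
Proof.
move=> A1 Meta B1.
have eta0 : forall a : 'I_N, 0 <= eta by move=> a; exact: le_trans (Meta a a).
rewrite mxE (le_trans (ler_norm_sum _ _ _))//.
have -> : (N ^ 2)%:R * eta = \sum_(b < N) \sum_(a < N) eta.
  by rewrite !sumr_const !card_ord -mulrnA mulnn mulr_natl.
apply: ler_sum => b _; rewrite mxE normrM.
apply: (@le_trans _ _ ((\sum_a `|A i a * M a b|) * 1)).
  by apply: ler_pM => //; exact: ler_norm_sum.
rewrite mulr1; apply: ler_sum => a _.
by rewrite normrM -[leRHS]mul1r ler_pM.
Qed.

(* Prefixes and suffixes of the two products are unitary, so the bound on the
   difference only grows linearly with the number of factors. *)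
Lemma unitary_hybrid g (G G' : 'I_g -> 'M[C]_N) V eta :
  (forall i, G i \is unitarymx) -> (forall i, G' i \is unitarymx) ->
  V \is unitarymx -> (forall i a b, `|(G i - G' i) a b| <= eta) ->
  forall a b, `|(V *m (\prod_(i < g) G i - \prod_(i < g) G' i)) a b| <=
    g%:R * ((N ^ 2)%:R * eta).
Proof.
move=> GU GU' VU close a b.
elim: g G G' V GU GU' VU close => [|g IH] G G' V GU GU' VU close.
  by rewrite !big_ord0 subrr mulmx0 mxE normr0 mul0r.
rewrite !big_ord_recl.
set P := \prod_(i < g) G _; set P' := \prod_(i < g) G' _.
have P'U : P' \is unitarymx by exact: unitary_prod.
have -> : V *m (G ord0 * P - G' ord0 * P') =
    (V *m G ord0) *m (P - P') + V *m (G ord0 - G' ord0) *m P'.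
  rewrite -[G ord0 * P]/(G ord0 *m P) -[G' ord0 * P']/(G' ord0 *m P').
  by rewrite !mulmxBr mulmxBl !mulmxA addrA subrK.
rewrite mxE (le_trans (ler_normD _ _))// -natr1 mulrDl mul1r lerD//.
  by apply: IH => //; exact: mul_unitarymx.
by apply: mulmx_entry_le => // ?; exact: unitary_entry_le1.
Qed.

End UnitaryProducts.

(** * Gates as operators on all qubits *)

Section ExtendGate.
Variables (R : realType) (n : nat).
Implicit Types (A : {set 'I_n}) (i j : 'I_(qdim n)).

Notation local_bits A := {ffun {k | k \in A} -> bool}.

Definition agree_outside A i j :=
  [forall (k | k \notin A),
     (enum_val i : bitstring n) k == (enum_val j : bitstring n) k].

Definition local_index A i : 'I_#|{: local_bits A}| :=
  enum_rank (restrict_bits A (enum_val i)).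

(** Inverse of [local_index A] on the class of the indices that agree with [i] outside [A]. *)
Definition glue A i (l : 'I_#|{: local_bits A}|) : 'I_(qdim n) :=
  enum_rank ([ffun k =>
    if insub k is Some k' then (enum_val l : local_bits A) k'
    else (enum_val i : bitstring n) k] : bitstring n).

Lemma agree_outsideP A i j :
  reflect (forall k, k \notin A ->
    (enum_val i : bitstring n) k = (enum_val j : bitstring n) k)
    (agree_outside A i j).
Proof.
apply: (iffP forallP) => [h k kA|h k].
  by have /implyP/(_ kA)/eqP := h k.
by apply/implyP => kA; apply/eqP; exact: h.
Qed.

Lemma agree_outside_local_inj A i j :
  agree_outside A i j -> local_index A i = local_index A j -> i = j.
Proof.
move=> /agree_outsideP ij /enum_rank_inj /ffunP lij.
apply: enum_val_inj; apply/ffunP => k.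
have [kA|] := boolP (k \in A); last exact: ij.
by have := lij (exist _ k kA); rewrite !ffunE.
Qed.

Lemma agree_glue A i (l : 'I_#|{: local_bits A}|) :
  agree_outside A i (glue i l).
Proof.
apply/agree_outsideP => k kA; rewrite /glue enum_rankK ffunE.
by rewrite insubN.
Qed.

Lemma local_glue A i (l : 'I_#|{: local_bits A}|) :
  local_index A (glue i l) = l.
Proof.
apply: enum_val_inj; rewrite /local_index enum_rankK; apply/ffunP => -[k kA].
by rewrite ffunE /glue enum_rankK ffunE /= insubT.
Qed.

Lemma glue_local A i j : agree_outside A i j -> glue i (local_index A j) = j.
Proof.
move=> /agree_outsideP ij; apply: (@agree_outside_local_inj A).
  apply/agree_outsideP => k kA; rewrite -ij//; apply/esym.
  exact: (agree_outsideP _ _ _ (agree_glue i _)).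
exact: local_glue.
Qed.

Lemma extend_gateE A (U : 'M[R[i]]_#|{: local_bits A}|) i j :
  extend_gate U i j =
  if agree_outside A i j then U (local_index A i) (local_index A j) else 0.
Proof. by rewrite mxE. Qed.

(** Two rows whose indices disagree outside [A] have disjoint supports. If they agree, their common
    support is parametrized by [glue], and their inner product is that of two rows of [U]. *)
Lemma extend_gate_unitary A (U : 'M[R[i]]_#|{: local_bits A}|) :
  U \is unitarymx -> extend_gate U \is unitarymx.
Proof.
move=> /unitarymxP UU; apply/unitarymxP/matrixP => i j.
rewrite mxE [RHS]mxE.
have [ij|Nij] := boolP (agree_outside A i j); last first.
  rewrite big1 => [|k _].
    by case: eqP Nij => [->|//]; move/agree_outsideP; case.
  rewrite !mxE -!/(agree_outside _ _ _).
  case: ifPn => [/agree_outsideP ik|]; last by rewrite mul0r.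
  case: ifPn => [/agree_outsideP jk|]; last by rewrite conjC0 mulr0.
  by case/agree_outsideP: Nij => l lA; rewrite ik// jk.
transitivity (\sum_l U (local_index A i) l * (U (local_index A j) l)^*).
  rewrite (bigID (agree_outside A i))/= [X in _ + X]big1 ?addr0; last first.
    by move=> k Nik; rewrite extend_gateE (negPf Nik) mul0r.
  rewrite (reindex_onto (@glue A i) (@local_index A)) => [|k]; last first.
    exact: glue_local.
  apply: eq_big => [l|l _]; first by rewrite agree_glue local_glue eqxx.
  rewrite !mxE -!/(agree_outside _ _ _) agree_glue.
  have -> : agree_outside A j (glue i l).
    apply/agree_outsideP => k kA.
    rewrite -(agree_outsideP _ _ _ ij)//.
    exact: (agree_outsideP _ _ _ (agree_glue i _)).
  by rewrite -!/(local_index _ _) local_glue.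
have /matrixP/(_ (local_index A i) (local_index A j)) := UU.
rewrite !mxE; under eq_bigr do rewrite !mxE.
move=> ->; congr (_%:R); congr (nat_of_bool _).
apply/eqP/eqP => [lij|-> //].
exact: agree_outside_local_inj lij.
Qed.

Lemma gate_unitary b (G : 'M[R[i]]_(qdim n)) : is_gate b G -> G \is unitarymx.
Proof. by case=> A [U [_ UU ->]]; exact: extend_gate_unitary. Qed.

(** The identity is a gate on the empty set of qubits; it pads short circuits to a fixed number of
    gates. *)
Lemma gate1 b : is_gate b (1%:M : 'M[R[i]]_(qdim n)).
Proof.
exists finset.set0, 1%:M; split; first by rewrite cards0.
  by apply/unitarymxP; rewrite trmx1 map_mx1 mulmx1.
apply/matrixP => i j; rewrite extend_gateE !mxE.
case: ifPn => [ij|/agree_outsideP Nij].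
  congr (_%:R); congr (nat_of_bool _); apply/eqP/eqP => [-> //|].
  exact: agree_outside_local_inj.
by case: eqP => // ij; case: Nij => k _; rewrite ij.
Qed.

End ExtendGate.

(** * Rounding of entries and codes of gates *)

Section Rounding.
Variables (R : realType) (k : nat).
Hypothesis k0 : (0 < k)%N.

(** For [x] in [-1, 1] the truncation lies in {0, ..., 2k}, where [inord] is faithful. *)
Definition round_real (x : R) : 'I_(k.*2.+1) :=
  inord (Num.truncn ((x + 1) * k%:R)).

Definition round_complex (z : R[i]) : 'I_(k.*2.+1) * 'I_(k.*2.+1) :=
  (round_real (complex.Re z), round_real (complex.Im z)).

Lemma round_real_inj (x y : R) : `|x| <= 1 -> `|y| <= 1 ->
  round_real x = round_real y -> `|x - y| <= k%:R^-1.
Proof.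
have k0' : 0 < k%:R :> R by rewrite ltr0n.
have itv (z : R) : `|z| <= 1 -> 0 <= (z + 1) * k%:R <= k.*2%:R.
  rewrite ler_norml => /andP[z1 z2]; rewrite mulr_ge0//=; last by lra.
  by rewrite -muln2 mulnC natrM ler_pM2r//; lra.
have val_round (z : R) : `|z| <= 1 ->
    (round_real z : nat) = Num.truncn ((z + 1) * k%:R).
  move=> /itv/andP[z0 z2]; rewrite /round_real inordK// ltnS.
  by rewrite -(ler_nat R) (le_trans _ z2)// truncn_le.
move=> x1 y1 /(congr1 (@nat_of_ord _)); rewrite !val_round// => xy.
have /andP[x0 _] := itv _ x1; have /andP[y0 _] := itv _ y1.
have /andP[xl xr] := truncn_itv x0; have /andP[yl yr] := truncn_itv y0.
rewrite -(ler_pM2r k0') mulVf ?gt_eqF// -[X in _ * X](ger0_norm (ltW k0')).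
rewrite -normrM mulrBl ler_norml.
move: xl xr yl yr; rewrite xy -natr1; lra.
Qed.

Lemma normc_le_ReIm (z : R[i]) :
  `|z| <= real_complex R (`|complex.Re z| + `|complex.Im z|).
Proof.
rewrite normc_def lecR -[leRHS]ger0_norm ?addr_ge0// -sqrtr_sqr.
rewrite ler_wsqrtr// sqrrD !real_normK ?num_real// lerD2r lerDl.
by rewrite mulrn_wge0// mulr_ge0.
Qed.

Lemma round_complex_inj (z w : R[i]) : `|z| <= 1 -> `|w| <= 1 ->
  round_complex z = round_complex w ->
  `|z - w| <= real_complex R (2 / k%:R).
Proof.
move=> z1 w1 [re im]; rewrite (le_trans (normc_le_ReIm _))// lecR.
have Re1 (x : R[i]) : `|x| <= 1 -> `|complex.Re x| <= 1.
  move=> x1; rewrite -lecR; exact: le_trans (normc_ge_Re _) x1.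
have Im1 (x : R[i]) : `|x| <= 1 -> `|complex.Im x| <= 1.
  move=> x1; rewrite -lecR; exact: le_trans (normc_ge_Im _) x1.
rewrite !raddfB mulr_natl mulr2n lerD//.
  by apply: round_real_inj => //; exact: Re1.
by apply: round_real_inj => //; exact: Im1.
Qed.

End Rounding.

Section GateCodes.
Variables (R : realType) (n b k : nat).
Hypothesis k0 : (0 < k)%N.

(* An enumeration of the qubits on which a gate acts, and its rounded matrix
   entries between bit strings that vanish outside these qubits. *)
Definition gate_code : finType :=
  ({ffun 'I_b -> option 'I_n} *
   {ffun {ffun 'I_b -> bool} * {ffun 'I_b -> bool} ->
      'I_(k.*2.+1) * 'I_(k.*2.+1)})%type.

Definition spread (e : {ffun 'I_b -> option 'I_n}) (x : {ffun 'I_b -> bool}) :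
    'I_(qdim n) :=
  enum_rank ([ffun l => [exists j, (e j == Some l) && x j]] : bitstring n).

Definition read_bits (e : {ffun 'I_b -> option 'I_n}) (i : 'I_(qdim n)) :
    {ffun 'I_b -> bool} :=
  [ffun j => if e j is Some l then (enum_val i : bitstring n) l else false].

(** A relation, since neither the set [A] nor its enumeration is determined by the gate. Reading
    entries of [G] at bit strings spread from b slots gives all codes the same type, whereas the
    size of the local unitary varies with [A]. *)
Definition has_gate_code (G : 'M[R[i]]_(qdim n)) (c : gate_code) : Prop :=
  exists A : {set 'I_n},
    [/\ forall l, (l \in A) = [exists j, c.1 j == Some l],
        forall i j, G i j = if agree_outside A i j
          then G (spread c.1 (read_bits c.1 i)) (spread c.1 (read_bits c.1 j))
          else 0 &
        forall x y, c.2 (x, y) =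
          round_complex k (G (spread c.1 x) (spread c.1 y))].

Lemma has_gate_code_ex G : is_gate b G -> exists c, has_gate_code G c.
Proof.
case=> A [U [Ab _ ->]].
(* The enumeration of [A] fills the first slots and [None] the remaining ones, up to length [b]. *)
pose e : {ffun 'I_b -> option 'I_n} :=
  [ffun j : 'I_b => nth None (map some (enum A)) j].
have eA l : (l \in A) = [exists j, e j == Some l].
  apply/idP/existsP => [lA|[j]].
    have lb : (index l (enum A) < b)%N.
      by rewrite (leq_trans _ Ab)// cardE index_mem mem_enum.
    exists (Ordinal lb); rewrite ffunE (nth_map l) ?index_mem ?mem_enum//=.
    by rewrite nth_index ?mem_enum.
  rewrite ffunE; have [jA|jA] := ltnP j (size (enum A)); last first.
    by rewrite nth_default ?size_map.
  rewrite (nth_map l)// => /eqP[<-].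
  by rewrite -mem_enum mem_nth.
clearbody e.
(* Reading and spreading back clears exactly the bits outside [A], so it does not change the local
   index. *)
have sr i l : (enum_val (spread e (read_bits e i)) : bitstring n) l =
    (l \in A) && (enum_val i : bitstring n) l.
  rewrite /spread enum_rankK ffunE eA.
  apply/existsP/andP => [[j /andP[/eqP ejl]]|[/existsP[j /eqP ejl] il]].
    rewrite ffunE ejl => il; split => //.
    by apply/existsP; exists j; rewrite ejl.
  by exists j; rewrite ffunE ejl eqxx.
exists (e, [ffun xy => round_complex k
  (extend_gate U (spread e xy.1) (spread e xy.2))]), A.
split => [//|i j|x y]; last by rewrite ffunE.
have local_sr i' : local_index A (spread e (read_bits e i')) = local_index A i'.
  congr enum_rank; apply/ffunP => -[l lA].
  by rewrite !ffunE sr /= lA.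
rewrite !extend_gateE; case: ifP => // ij.
have -> : agree_outside A (spread e (read_bits e i)) (spread e (read_bits e j)).
  by apply/agree_outsideP => l /negPf lA; rewrite !sr lA.
by rewrite !local_sr.
Qed.

(** The code determines [A], so both gates vanish at the same positions; elsewhere equal roundings
    leave an error of 1/k in each of the real and imaginary parts. *)
Lemma same_gate_code_close G G' c : G \is unitarymx -> G' \is unitarymx ->
  has_gate_code G c -> has_gate_code G' c ->
  forall i j, `|(G - G') i j| <= real_complex R (2 / k%:R).
Proof.
move=> GU GU' [A [cA GA Gr]] [A' [cA' GA' Gr']] i j.
have AA' : A = A' by apply/setP => l; rewrite cA cA'.
rewrite !mxE GA GA' AA'; case: ifP => _; last first.
  by rewrite subrr normr0 ler0c divr_ge0.
apply: round_complex_inj; rewrite ?unitary_entry_le1//.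
by rewrite -Gr -Gr'.
Qed.

Lemma card_gate_code :
  #|gate_code| = (n.+1 ^ b * (k.*2.+1 ^ 2) ^ ((2 ^ b) ^ 2))%N.
Proof.
rewrite card_prod !card_ffun card_option !card_prod !card_ffun card_bool.
by rewrite !card_ord !mulnn.
Qed.

End GateCodes.

(** For x <= y this is subadditivity of the square root, checked by squaring. A negative [x] is
    allowed because its [Num.sqrt] is 0. *)
Lemma ler_dist_sqrt (R : rcfType) (x y : R) :
  `|Num.sqrt x - Num.sqrt y| <= Num.sqrt `|x - y|.
Proof.
wlog xy : x y / x <= y => [hw|].
  have [/hw//|/ltW/hw] := leP x y.
  by rewrite distrC [`|x - y|]distrC.
rewrite distrC ger0_norm ?subr_ge0 ?ler_wsqrtr// lerBlDr.
rewrite distrC ger0_norm ?subr_ge0//.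
have [x0|x0] := leP x 0.
  apply: (@le_trans _ _ (Num.sqrt (y - x))).
    by rewrite ler_wsqrtr// lerDl oppr_ge0.
  by rewrite lerDl sqrtr_ge0.
rewrite -(@ler_pXn2r _ 2)// ?nnegrE ?addr_ge0 ?sqrtr_ge0//.
have y0 : 0 <= y by rewrite (le_trans (ltW x0)).
rewrite sqr_sqrtr// sqrrD !sqr_sqrtr ?subr_ge0 ?(ltW x0)//.
rewrite addrAC subrK lerDl mulrn_wge0// mulr_ge0// sqrtr_ge0.
Qed.

(** * Codes of circuits and the cover they define *)

Section CircuitCodes.
Variables (R : realType) (n b : nat) (c : R) (k : nat).
Hypothesis k0 : (0 < k)%N.
Let g := Num.truncn (n%:R `^ c : R).
Let D := #|{: bitstring n}|.

Definition circuit_code : finType := {ffun 'I_g -> gate_code n b k}.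

Definition has_circuit_code (C : 'M[R[i]]_(qdim n)) (q : circuit_code) : Prop :=
  exists G : 'I_g -> 'M[R[i]]_(qdim n),
    (forall i, is_gate b (G i) /\ has_gate_code (G i) (q i)) /\
    C = \prod_(i < g) G i.

Lemma has_circuit_code_ex C : circuits b c C -> exists q, has_circuit_code C q.
Proof.
case=> gs [gsP size_gs ->].
have gsg : (size gs <= g)%N.
  by rewrite /g truncn_ge_nat ?powR_ge0.
(* Beyond the end of [gs] the default value 1 of [nth] supplies identity gates, so that every
   circuit has exactly [g] factors. *)
pose G (i : nat) : 'M[R[i]]_(qdim n) := nth 1 gs i.
have GP (i : 'I_g) : is_gate b (G i).
  rewrite /G; have [ib|ib] := ltnP i (size gs).
    by apply: gsP; rewrite mem_nth.
  by rewrite nth_default//; exact: gate1.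
have /fin_all_exists[q qP] : forall i : 'I_g, exists q : gate_code n b k,
    has_gate_code (G i) q by move=> i; exact: has_gate_code_ex.
exists [ffun i => q i], (fun i => G i); split.
  by move=> i; rewrite ffunE.
rewrite (big_nth 1) -(big_mkord xpredT G) (big_cat_nat (leq0n _) gsg)/=.
rewrite [X in _ = _ * X]big_nat [X in _ = _ * X]big1 ?mulr1//.
by move=> i /andP[si _]; rewrite /G nth_default.
Qed.

Lemma has_circuit_code_unitary C q : has_circuit_code C q -> C \is unitarymx.
Proof.
case=> G [GP ->]; apply: unitary_prod => i.
by apply: (@gate_unitary _ _ b); case: (GP i).
Qed.

Lemma same_circuit_code_close C C' q :
  has_circuit_code C q -> has_circuit_code C' q -> forall i j,
  `|(C - C') i j| <=
    g%:R * ((D ^ 2)%:R * real_complex R (2 / k%:R)).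
Proof.
move=> [G [GP ->]] [G' [GP' ->]] i j.
have GU l : G l \is unitarymx by apply: (@gate_unitary _ _ b); case: (GP l).
have GU' l : G' l \is unitarymx by apply: (@gate_unitary _ _ b); case: (GP' l).
rewrite -[\prod_(l < g) G l - _]mul1mx.
have V1 : (1%:M : 'M[R[i]]_(qdim n)) \is unitarymx.
  by apply/unitarymxP; rewrite trmx1 map_mx1 mulmx1.
apply: (unitary_hybrid GU GU' V1) => l a d.
have [_ Gq] := GP l; have [_ Gq'] := GP' l.
exact: (same_gate_code_close k0 (GU l) (GU' l) Gq Gq' a d).
Qed.

Lemma overlap_le (x y : pure_state R n) (M : 'M[R[i]]_(qdim n)) eta :
  (forall i j, `|M i j| <= eta) ->
  `|overlap (ket y) (M *m ket x)| <= (D ^ 2)%:R * eta.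
Proof.
have ket1 (z : pure_state R n) i : `|ket z i 0| <= 1.
  have /matrixP/(_ 0 0) := ket_unit z.
  rewrite !mxE eqxx mulr1n (bigD1 i)//= !mxE mulrC -normCK => zE.
  rewrite -(@expr_le1 _ 2)// -zE lerDl sumr_ge0// => l _.
  by rewrite !mxE mulrC -normCK exprn_ge0.
move=> Meta; rewrite /overlap mulmxA.
by apply: mulmx_entry_le => // i; rewrite !mxE norm_conjC.
Qed.

Lemma sqnormc_dist (s t : R[i]) (B eta : R) :
  `|s| <= real_complex R B -> `|t| <= real_complex R B ->
  `|s - t| <= real_complex R eta ->
  `|sqnormc s - sqnormc t| <= 2 * B * eta.
Proof.
have nE (z : R[i]) : `|z| = real_complex R (ComplexField.Normc.normc z).
  by case: z.
have sqE (z : R[i]) : sqnormc z = ComplexField.Normc.normc z ^+ 2.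
  by apply: (@complexI R); rewrite sqnormcE rmorphXn /= -nE.
have n0 (z : R[i]) : 0 <= ComplexField.Normc.normc z.
  by rewrite -ler0c -nE normr_ge0.
move=> sB tB st.
have h1 : ComplexField.Normc.normc s - ComplexField.Normc.normc t <= eta.
  by rewrite -lecR rmorphB /= -!nE (le_trans (lerB_dist _ _)).
have h2 : ComplexField.Normc.normc t - ComplexField.Normc.normc s <= eta.
  by rewrite -lecR rmorphB /= -!nE (le_trans (lerB_dist _ _))// distrC.
move: sB tB; rewrite !nE !lecR => sB tB.
rewrite !sqE subr_sqr normrM mulrC ler_pM//.
  by rewrite ger0_norm ?addr_ge0//; lra.
by rewrite ler_norml; lra.
Qed.

Lemma same_circuit_code_loss C C' q (x y : pure_state R n) :
  has_circuit_code C q -> has_circuit_code C' q ->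
  `|overlap_loss (ket y) (C *m ket x) - overlap_loss (ket y) (C' *m ket x)| <=
    Num.sqrt (4 * g%:R * D%:R ^+ 6 / k%:R).
Proof.
move=> Cq Cq'.
have CU := has_circuit_code_unitary Cq.
have CU' := has_circuit_code_unitary Cq'.
apply: (le_trans (ler_dist_sqrt _ _)); apply: ler_wsqrtr.
rewrite opprB addrC addrA subrK.
(* The factors are 2 B with the crude bound B = D^2 on the overlaps, then D^2 from passing to matrix
   entries, and finally the error g D^2 (2 / k) of the product of gates. *)
have -> : 4 * g%:R * D%:R ^+ 6 / k%:R =
    2 * (D ^ 2)%:R * ((D ^ 2)%:R * (g%:R * ((D ^ 2)%:R * (2 / k%:R)))) :> R.
  rewrite !natrX; ring.
apply: sqnormc_dist.
- rewrite rmorph_nat -[leRHS]mulr1; apply: overlap_le => i j.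
  exact: (unitary_entry_le1 i j CU').
- rewrite rmorph_nat -[leRHS]mulr1; apply: overlap_le => i j.
  exact: (unitary_entry_le1 i j CU).
rewrite distrC.
have -> : overlap (ket y) (C *m ket x) - overlap (ket y) (C' *m ket x) =
    overlap (ket y) ((C - C') *m ket x).
  by rewrite /overlap mulmxBl mulmxBr [RHS]mxE [X in _ = _ + X]mxE.
rewrite (rmorphM (real_complex R) (D ^ 2)%:R _) rmorph_nat.
rewrite (rmorphM (real_complex R) g%:R _) rmorph_nat.
rewrite (rmorphM (real_complex R) (D ^ 2)%:R _) rmorph_nat.
apply: overlap_le.
exact: same_circuit_code_close Cq Cq'.
Qed.

End CircuitCodes.

Lemma card_circuit_code (R : realType) n b (c : R) k :
  #|circuit_code n b c k| =
  ((n.+1 ^ b * (k.*2.+1 ^ 2) ^ ((2 ^ b) ^ 2)) ^ Num.truncn (n%:R `^ c : R))%N.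
Proof. by rewrite card_ffun card_gate_code card_ord. Qed.

Lemma circuit_pac (R : realType) (n b : nat) (c : R) (k : nat) (eps delta : R)
    (P : probability (pure_state R n * pure_state R n)%type R) (m : nat)
    (hhat : m.-tuple (pure_state R n * pure_state R n) ->
      pure_state R n -> pure_state R n)
    (h : pure_state R n -> pure_state R n) :
  (0 < k)%N -> 0 < eps < 1 ->
  4 * (Num.truncn (n%:R `^ c))%:R * 2 ^+ (6 * n) / k%:R <= (eps / 8) ^+ 2 ->
  (#|circuit_code n b c k|)%:R *
    (2 * expR (- (m%:R * (eps ^+ 2 / 128)))) <= delta ->
  (forall S, is_argmin (circuit_functions b c)
     (empirical_risk (@trace_loss R n) S) (hhat S)) ->
  is_argmin (circuit_functions b c) (risk (@trace_loss R n) P) h ->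
  ((1 - delta)%:E <= inner_prob (iid P m)
    [set S | (risk (@trace_loss R n) P (hhat S) -
              risk (@trace_loss R n) P h <= eps)%R])%E.
Proof.
move=> k0 eps01 keps Ndelta hhatP hP.
have e0 : 0 <= eps / 8 by move: eps01; lra.
(* Each code that occurs is represented by some operator having it; the identity is a placeholder
   for codes that do not occur. *)
have /choice[rep repP] : forall q : circuit_code n b c k,
    exists C : 'M[R[i]]_(qdim n),
      (exists C', has_circuit_code C' q) -> has_circuit_code C q.
  move=> q.
  have [[C Cq]|Nq] := pselect (exists C', @has_circuit_code R n b c k C' q).
    by exists C.
  by exists 1.
pose loss_of (q : circuit_code n b c k)
    (z : pure_state R n * pure_state R n) :=
  overlap_loss (ket z.2) (rep q *m ket z.1).
apply: (@pac_of_finite_cover _ _ _ _ _ (@trace_loss R n)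
  (circuit_functions b c) (circuit_code n b c k) loss_of) => //.
- by move=> q; exact: overlap_loss_measurable.
- by move=> q z; exact: overlap_loss01.
(* Measurability of the loss is obtained from the overlap with the fixed matrix [C], without asking
   whether [f] is measurable. *)
- move=> f [C _ fC].
  apply: (eq_measurable_fun (fun z => overlap_loss (ket z.2) (C *m ket z.1))).
    by move=> z _; rewrite (trace_loss_overlap _ (fC z.1)).
  exact: overlap_loss_measurable.
- exact: trace_loss01.
- move=> f [C Ccirc fC].
  have [q Cq] := has_circuit_code_ex k Ccirc.
  exists q => z; rewrite (trace_loss_overlap _ (fC z.1)).
  have Rq : has_circuit_code (rep q) q by apply: repP; exists C.
  apply: (le_trans (same_circuit_code_loss k0 z.1 z.2 Cq Rq)).
  rewrite -[leRHS]ger0_norm// -sqrtr_sqr; apply: ler_wsqrtr.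
  by rewrite card_ffun card_bool card_ord natrX -exprM mulnC.
Qed.

(** * Sample size *)

Section SampleComplexity.
Variables (R : realType) (b : nat) (c : R).
Hypothesis c0 : 0 <= c.

Definition gate_budget (n : nat) : nat := Num.truncn (n%:R `^ c : R).

(* Makes [4 * gate_budget n * 2 ^ (6 * n) / grid n eps] at most
   [(eps / 8) ^+ 2]. *)
Definition grid (n : nat) (eps : R) : nat :=
  (Num.truncn (256 * (gate_budget n)%:R * 2 ^+ (6 * n) * eps ^- 2)).+1.

Definition code_count (n : nat) (eps : R) : nat :=
  ((n.+1 ^ b * ((grid n eps).*2.+1 ^ 2) ^ ((2 ^ b) ^ 2)) ^ gate_budget n)%N.

(** The summands pay, in units of n^(c+1) ln(n / eps), for the factor 2 of the two-sided tail, for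
    the choice of qubits, and for the real and imaginary parts of the 4^b rounded entries. *)
Definition log_count_constant : R :=
  1 + 2 * b%:R + 2 * ((2 ^ b) ^ 2)%:R * (18 + c).

(** The factor 128 cancels the one in the exponent of the tail bound; the final 1 absorbs the
    truncation in [sample_size], as the rate is at least 1. *)
Definition sample_constant : R := 128 * log_count_constant + 1.

Definition sample_rate (n : nat) (eps delta : R) : R :=
  eps ^- 2 * (n%:R `^ (c + 1) * ln (n%:R / eps) + ln delta^-1).

Definition sample_size (n : nat) (eps delta : R) : nat :=
  Num.truncn (sample_constant * sample_rate n eps delta).

(** The quadratic bound at 1/2 gives exp(1/2) <= 1 + 1/2 + 2/4 = 2. *)
Lemma ln2_ge : 2^-1 <= ln (2 : R).
Proof.
rewrite -[leLHS]expRK ler_ln ?posrE ?expR_gt0//.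
apply: (le_trans (expR_le_quadratic _)) => //.
by rewrite le_eqVlt; apply/orP; left; apply/eqP; field.
Qed.

Lemma log_count_constant_ge1 : 1 <= log_count_constant.
Proof.
rewrite /log_count_constant -addrA lerDl addr_ge0 ?mulr_ge0 ?addr_ge0//.
Qed.

Section Fixed.
Variables (n : nat) (eps delta : R).
Hypothesis n2 : (2 <= n)%N.
Hypothesis eps01 : 0 < eps < 1.
Hypothesis delta01 : 0 < delta < 1.

Let L := ln (n%:R / eps).
Let eps_gt0 : 0 < eps. Proof. by case/andP: eps01. Qed.
Let n_ge2 : 2 <= n%:R :> R. Proof. by rewrite ler_nat. Qed.
Let n_gt0 : 0 < n%:R :> R. Proof. exact: lt_le_trans n_ge2. Qed.

Let LE : L = ln n%:R - ln eps.
Proof. by rewrite /L ln_div ?posrE. Qed.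

Let lneps_lt0 : ln eps < 0.
Proof. by case/andP: eps01 => e0 e1; rewrite ln_lt0// e0. Qed.

Let ln2n : ln 2 <= ln n%:R :> R.
Proof. by rewrite ler_ln ?posrE. Qed.

Let ln2_pos : 2^-1 <= ln 2 :> R := ln2_ge.

Let nlnn : ln n%:R <= n%:R * ln n%:R :> R.
Proof.
by rewrite -[leLHS]mul1r ler_wpM2r//; move: ln2n ln2_pos n_ge2; lra.
Qed.

Let nlneps : n%:R * ln eps <= ln eps.
Proof.
by rewrite -[leRHS]mul1r ler_wnM2r ?(ltW lneps_lt0)//; move: n_ge2; lra.
Qed.

Let powc1 : 1 <= n%:R `^ c.
Proof.
rewrite -[leLHS](powRr0 n%:R) ler_powR//.
by rewrite (le_trans _ n_ge2)// ler1n.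
Qed.

Let powS : n%:R `^ (c + 1) = n%:R `^ c * n%:R :> R.
Proof.
by rewrite powRD ?powRr1 ?ler0n// (gt_eqF n_gt0) implybT.
Qed.

Let gate_budget_le : (gate_budget n)%:R <= n%:R `^ c :> R.
Proof. by rewrite /gate_budget truncn_le powR_ge0. Qed.

Lemma sample_rate_ge1 : 1 <= sample_rate n eps delta.
Proof.
have ln_delta : 0 <= ln delta^-1.
  by case/andP: delta01 => d0 d1; rewrite ln_ge0// invf_ge1// ltW.
have e1 : 1 <= eps ^- 2.
  case/andP: eps01 => e0 e1.
  by rewrite invf_ge1 ?exprn_gt0// exprn_ile1// ltW.
have nL : 1 <= n%:R `^ (c + 1) * L.
  have h1 : 1 <= n%:R * L by move: LE ln2n ln2_pos lneps_lt0 n_ge2; nra.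
  by rewrite powS -mulrA -[leLHS]mulr1 ler_pM.
rewrite /sample_rate -[leLHS]mulr1 ler_pM//.
by rewrite -/L; lra.
Qed.

Lemma grid_spec :
  4 * (gate_budget n)%:R * 2 ^+ (6 * n) / (grid n eps)%:R <= (eps / 8) ^+ 2.
Proof.
rewrite ler_pdivrMr ?ltr0n//.
set x := 256 * (gate_budget n)%:R * 2 ^+ (6 * n) * eps ^- 2.
have x0 : 0 <= x.
  have e20 : 0 <= eps ^- 2 by rewrite invr_ge0 exprn_ge0// ltW.
  have p20 : 0 <= 2 ^+ (6 * n) :> R by rewrite exprn_ge0.
  exact: (mulr_ge0 (mulr_ge0 (mulr_ge0 (ler0n R 256) (ler0n R _)) p20) e20).
have /andP[_ /ltW xk] := truncn_itv x0.
have -> : 4 * (gate_budget n)%:R * 2 ^+ (6 * n) = (eps / 8) ^+ 2 * x.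
  by rewrite /x; field; rewrite gt_eqF.
by rewrite ler_wpM2l ?sqr_ge0.
Qed.

Let ln_grid : ln (grid n eps).*2.+1%:R <= (18 + c) * (n%:R * L) :> R.
Proof.
set x := 256 * (gate_budget n)%:R * 2 ^+ (6 * n) * eps ^- 2.
(* Since k <= x + 1, the number 2k + 1 is at most 2x + 3, that is 512 times a quantity bounded by
   n^c 2^(6n) eps^-2, plus 3. The latter product is at least 1, so 1024 is ample. The exponents 10,
   6 and 2 in [y] add up to the 18 of the bound. *)
set y := 2 ^+ 10 * n%:R `^ c * 2 ^+ (6 * n) * eps ^- 2.
have e1 : 1 <= eps ^- 2.
  case/andP: eps01 => e0 e1.
  by rewrite invf_ge1 ?exprn_gt0// exprn_ile1// ltW.
have p2 : 1 <= 2 ^+ (6 * n) :> R by rewrite exprn_ege1// ler1n.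
have T1 : 1 <= 2 ^+ (6 * n) * eps ^- 2 by rewrite -[leLHS]mulr1 ler_pM.
have xE : x = 256 * ((gate_budget n)%:R * (2 ^+ (6 * n) * eps ^- 2)).
  by rewrite /x !mulrA.
have yE : y = 1024 * (n%:R `^ c * (2 ^+ (6 * n) * eps ^- 2)).
  rewrite /y !mulrA; congr (_ * _ * _ * _).
  by rewrite -natrX.
have xk : 0 <= x -> (grid n eps)%:R <= x + 1.
  by move=> x0; rewrite -natr1 lerD2r truncn_le.
have ky : (grid n eps).*2.+1%:R <= y.
  rewrite -natr1 -muln2 natrM yE; move: xk; rewrite xE.
  move: (2 ^+ (6 * n) * eps ^- 2) T1 (gate_budget n)%:R gate_budget_le
    (ler0n R (gate_budget n)) => T T1 gR gc g0 xk.
  have gT : 0 <= gR * T by rewrite mulr_ge0//; lra.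
  have gcT : gR * T <= n%:R `^ c * T by rewrite ler_wpM2r//; lra.
  have cT : 1 <= n%:R `^ c * T by rewrite -[leLHS]mulr1 ler_pM.
  have {}xk : (grid n eps)%:R <= 256 * (gR * T) + 1.
    exact: (xk (mulr_ge0 (ler0n R 256) gT)).
  lra.
have y0 : 0 < y by rewrite (lt_le_trans _ ky)// ltr0n.
apply: (@le_trans _ _ (ln y)); first by rewrite ler_ln ?posrE ?ltr0n.
have e20 : 0 < eps ^- 2 by rewrite invr_gt0 exprn_gt0.
have c_0 : 0 < n%:R `^ c by rewrite powR_gt0.
have t0 k : 0 < 2 ^+ k :> R by rewrite exprn_gt0.
rewrite /y !lnM ?posrE ?mulr_gt0// lnV ?posrE ?exprn_gt0// !lnXn// ln_powR.
rewrite -[ln 2 *+ (6 * n)]mulr_natl -[ln eps *+ 2]mulr_natl natrM LE.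
have cn : c * ln n%:R <= c * (n%:R * (ln n%:R - ln eps)).
  by apply: ler_wpM2l => //; move: nlnn nlneps lneps_lt0; lra.
have na : n%:R * ln 2 <= n%:R * ln n%:R :> R by rewrite ler_wpM2l.
move: ln2_pos ln2n lneps_lt0 cn na nlnn nlneps; lra.
Qed.

Lemma ln_code_count : ln ((code_count n eps)%:R * 2) <=
  log_count_constant * (n%:R `^ (c + 1) * L).
Proof.
have L0 : 2^-1 <= L by move: LE ln2n ln2_pos lneps_lt0; lra.
have nL0 : 0 <= n%:R * L by rewrite mulr_ge0//; lra.
set B : R := ((2 ^ b) ^ 2)%:R.
have lnN : ln (code_count n eps)%:R = (gate_budget n)%:R *
    (b%:R * ln n.+1%:R + (2 * (2 ^ b) ^ 2)%:R * ln (grid n eps).*2.+1%:R) :> R.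
  rewrite /code_count natrX lnXn ?ltr0n ?(expn_gt0, muln_gt0)// natrM.
  rewrite lnM ?posrE ?ltr0n ?expn_gt0// -expnM !natrX !lnXn ?ltr0n//.
  by rewrite !mulr_natl.
rewrite lnM ?posrE ?ltr0n//; last by rewrite !(expn_gt0, muln_gt0).
rewrite lnN natrM -/B.
have lnS : ln n.+1%:R <= 2 * (n%:R * L) :> R.
  (* For n >= 2 one has n + 1 <= n^2, which turns ln(n + 1) into a multiple of ln n. *)
  apply: (@le_trans _ _ (ln (n%:R ^+ 2))).
    rewrite ler_ln ?posrE ?ltr0n ?exprn_gt0// -natr1.
    by move: n_ge2; nra.
  rewrite lnXn// -[ln _ *+ 2]mulr_natl LE.
  by move: nlnn nlneps lneps_lt0; lra.
have B0 : 0 <= B by exact: ler0n.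
have inner : b%:R * ln n.+1%:R + 2 * B * ln (grid n eps).*2.+1%:R <=
    (2 * b%:R + 2 * B * (18 + c)) * (n%:R * L).
  rewrite [leRHS]mulrDl lerD//.
    by rewrite [2 * b%:R]mulrC -mulrA ler_wpM2l.
  by rewrite -[leRHS]mulrA ler_wpM2l// mulr_ge0.
have K0 : 0 <= 2 * b%:R + 2 * B * (18 + c).
  by rewrite addr_ge0 ?mulr_ge0 ?addr_ge0.
rewrite powS /log_count_constant -/B.
apply: (@le_trans _ _ (n%:R `^ c * ((2 * b%:R + 2 * B * (18 + c)) * (n%:R * L))
   + n%:R `^ c * (n%:R * L))).
  apply: lerD.
    apply: (@le_trans _ _ ((gate_budget n)%:R *
      ((2 * b%:R + 2 * B * (18 + c)) * (n%:R * L)))).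
      by rewrite ler_wpM2l.
    by rewrite ler_wpM2r// mulr_ge0.
  apply: (@le_trans _ _ (n%:R * L)).
    by rewrite LE; move: ln2n nlnn nlneps lneps_lt0; lra.
  by rewrite -[leLHS]mul1r ler_wpM2r.
by rewrite le_eqVlt; apply/orP; left; apply/eqP; ring.
Qed.

Lemma sample_size_le :
  (sample_size n eps delta)%:R <= sample_constant * sample_rate n eps delta.
Proof.
rewrite /sample_size truncn_le mulr_ge0//.
  by rewrite addr_ge0// mulr_ge0// (le_trans _ log_count_constant_ge1).
by rewrite (le_trans _ sample_rate_ge1).
Qed.

Lemma failure_probability_le (m : nat) : (sample_size n eps delta <= m)%N ->
  (code_count n eps)%:R * (2 * expR (- (m%:R * (eps ^+ 2 / 128)))) <= delta.
Proof.
move=> num.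
have /andP[d0 d1] := delta01.
set X := sample_rate n eps delta.
have X1 : 1 <= X := sample_rate_ge1.
have M1 := log_count_constant_ge1.
have KX0 : 0 <= sample_constant * X.
  by rewrite mulr_ge0 ?(le_trans _ X1)// /sample_constant; lra.
have /andP[_ KXm] := truncn_itv KX0.
have mX : 128 * log_count_constant * X <= m%:R.
  have : sample_constant * X < m%:R + 1.
    by rewrite (lt_le_trans KXm)// natr1 ler_nat ltnS.
  by rewrite /sample_constant mulrDl mul1r; lra.
have N0 : 0 < (code_count n eps)%:R * 2 :> R.
  by rewrite mulr_gt0// ltr0n !(expn_gt0, muln_gt0).
rewrite mulrA -[X in X * _]lnK ?posrE// -expRD -[leRHS]lnK ?posrE//.
rewrite ler_expR.
have lc := ln_code_count.
set T := n%:R `^ (c + 1) * L in lc.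
(* Multiplying the rate by eps^2 leaves T + ln(1/delta). Scaled by the constant, its first term
   covers the logarithm of twice the number of codes, and its second covers ln(1/delta) because the
   constant is at least 1. *)
have XE : X * (eps ^+ 2 / 128) = (T + ln delta^-1) / 128.
  by rewrite /X /sample_rate -/L -/T; field; rewrite gt_eqF.
have : 128 * log_count_constant * X * (eps ^+ 2 / 128) <=
    m%:R * (eps ^+ 2 / 128).
  by rewrite ler_wpM2r// divr_ge0// sqr_ge0.
rewrite -[_ * X * _]mulrA XE lnV ?posrE//.
have ld : ln delta < 0 by rewrite ln_lt0// d0.
set w := m%:R * _; move: lc M1 ld; nra.
Qed.

End Fixed.
End SampleComplexity.

Theorem mainTheorem3 (R : realType) (b : nat) (c : R) (hb : (1 <= b)%N)
    (hc : 0 <= c) :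
  exists (K : R) (nu : nat -> R -> R -> nat),
    forall n : nat, (2 <= n)%N ->
      pac_learnable (@trace_loss R n) (@circuit_functions R n b c) (nu n) /\
      forall eps delta : R, 0 < eps < 1 -> 0 < delta < 1 ->
        (nu n eps delta)%:R <=
          K * (eps ^- 2 *
            (n%:R `^ (c + 1) * ln (n%:R / eps) + ln delta^-1)).
Proof.
exists (sample_constant b c), (sample_size b c) => n n2; split; last first.
  by move=> eps delta eps01 delta01; exact: sample_size_le.
move=> eps delta eps01 delta01 P m num hhat h hhatP hP.
apply: (@circuit_pac _ _ b c (grid c n eps)) => //; first exact: grid_spec.
by rewrite card_circuit_code; exact: failure_probability_le num.
Qed.
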